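(* For every $n\ge 1$, each fiber of the map $\gamma:S_n\to\mathrm{gRec}_n$ is a congruence class of the congruence $\Gamma$ on the weak order on $S_n$. In particular, each fiber of $\gamma$ contains a unique $2$-clumped permutation.
   Context: **Permutations.** Permutations $x\in S_n$ are written in one-line notation $x=x_1x_2\cdots x_n$. The weak order on $S_n$ is the lattice whose cover relations are $x\lessdot y$ where, for some $i$, $x_i=y_{i+1}<y_i=x_{i+1}$ and $x_j=y_j$ for $j\notin\{i,i+1\}$. A descent of $x$ is a pair of adjacent entries $x_i>x_{i+1}$. A *clump* associated to the descent $x_i>x_{i+1}$ is a nonempty maximal sequence of consecutive integers (values) strictly between $x_{i+1}$ and $x_i$, all of which occur in $x$ on the same side of the adjacent entries $x_ix_{i+1}$ (all to the left of $x_i$ or all to the right of $x_{i+1}$; no requirement on their positions relative to each other). A permutation is *$2$-clumped* if each of its descents has at most $2$ clumps. (Equivalently, it avoids the generalized patterns $3$-$51$-$2$-$4$, $3$-$51$-$4$-$2$, $2$-$4$-$51$-$3$, $4$-$2$-$51$-$3$, where entries not separated by a dash must be adjacent in the permutation.) **The congruence $\Gamma$.** $\Gamma$ is the unique lattice congruence on the weak order on $S_n$ (known to exist) such that, for every cover $x\lessdot y$, with $e$ and $a$ ($a<e$) the adjacent entries swapped to convert $y$ to $x$: $x\equiv y$ modulo $\Gamma$ if and only if there are entries $b,c,d$ in $y$ with $a<b<c<d<e$ such that $b$ and $d$ are on the same side of the adjacent pair $ea$ in $y$, while $c$ is on the other side of $ea$. (Since congruence classes of a finite lattice are intervals, $\Gamma$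 is the equivalence relation generated by these cover relations.) **Generic rectangulations.** Consider tilings of a rectangle $S$ (with horizontal and vertical edges) by finitely many rectangles. A tiling is *generic* if no point is a corner of four distinct tiles. A tile $U$ is *below* a tile $V$ if the top edge of $U$ intersects the bottom edge of $V$; $U$ is *left of* $V$ if the right edge of $U$ intersects the left edge of $V$. Two tilings (of possibly different rectangles) are combinatorially equivalent if there is a bijection between their tiles that exactly preserves the relations ''below'' and ''left of''. A *generic rectangulation* is an equivalence class of generic tilings; $\mathrm{gRec}_n$ is the set of generic rectangulations with $n$ rectangles. Rectangulations are described by representative tilings. **Diagonal rectangulations.** The diagonal of $S$ is the segment from its top-left corner to its bottom-right corner. A *diagonal rectangulation* is a rectangulation having a representative in which the interior of every rectangle meets the diagonal; it is automatically generic. Its rectangles are numbered $1,\dots,n$ in the order in which they meet the diagonal, from top-left to bottom-right. **The map $\rho$ from $S_n$ to diagonal rectangulations with $n$ rectangles.** Place $n+1$ distinct points on the diagonal of $S$, including the top-left and bottom-right corners of $S$, and label the spaces between consecutive points $1,\dots,n$ from top-left to bottom-right. Given $x\in S_n$, draw rectangles in steps $i=1,\dots,n$. In step $i$, let $T$ be the union of the left and bottom edges of $S$ with the rectangles drawn in the first $i-1$ steps ($T$ is left- and bottom-justified). Let $p$ and $p'$ be the diagonal points immediately above/left of, respectively immediately below/right of, the label $x_i$. The new rectangle has the following corners. Top-left corner: if $p\notin T$, the rightmost point of $T$ directly left of $p$; if $p\in T$, the highest point of $T$ directly above $p$ (possibly $p$ itself). Bottom-right corner: if $p'\notin T$, the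 highest point of $T$ directly below $p'$; if $p'\in T$, the rightmost point of $T$ directly to the right of $p'$ (possibly $p'$ itself). The result after $n$ steps is $\rho(x)$; the rectangle drawn in step $i$ is the one numbered $x_i$. **Walls, wall slides, numbering.** A *wall* of a rectangulation is a line segment in $S$, not contained in an edge of $S$, that is maximal with respect to not intersecting the interior of any rectangle. A *wall slide* along a wall $W$ takes two walls that end in $W$ from opposite sides and slides them past each other, changing no other incidences. Two generic rectangulations are *equivalent as mosaic floorplans* if they are related by a sequence of wall slides. It is known that each generic rectangulation $R$ is equivalent as a mosaic floorplan to a unique diagonal rectangulation $R'$. The walls and rectangles of $R$ correspond to those of $R'$ along wall slides (preserving, for each wall, which rectangles are adjacent to it on each side and their order), and the rectangles of $R$ inherit the numbering $1,\dots,n$ from $R'$. **Wall shuffles.** For a vertical wall $W$ of $R$, the *wall shuffle* $\sigma_W$ is the following sequence: moving along $W$ from bottom to top, at each wall $W'$ that ends at $W$ on the left, record the number of the rectangle with right edge in $W$ and bottom edge in $W'$; at each wall $W'$ that ends at $W$ on the right, record the number of the rectangle with left edge in $W$ and top edge in $W'$. Thus $\sigma_W$ is a shuffle of the (decreasing) sequence of numbers, from bottom to top, of rectangles whose right edge is in $W$, excluding the bottom one, with the (decreasing) sequence of numbers, from bottom to top, of rectangles whose left edge is in $W$, excluding the top one. For a horizontal wall $W$: moving from left to right, at each wall $W'$ that ends at $W$ from above, record the number of the rectangle with bottom edge in $W$ and right edge in $W'$; at each $W'$ that ends at $W$ from below, record the number of the rectangle with top edge in $W$ and left edge in $W'$.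 Thus $\sigma_W$ is a shuffle of the (increasing) sequence of numbers, from left to right, of rectangles whose bottom edge is in $W$, excluding the rightmost, with the (increasing) sequence of numbers, from left to right, of rectangles whose top edge is in $W$, excluding the leftmost. Specifying a generic rectangulation is equivalent to specifying its diagonal rectangulation $R'$ together with an arbitrary, independently chosen wall shuffle (a shuffle of the two sequences just described) for each wall of $R'$. **The map $\gamma:S_n\to\mathrm{gRec}_n$.** Given $x\in S_n$, let $R'=\rho(x)$. For each wall $W$ of $R'$, each of the two sequences of rectangle numbers to be shuffled for $W$ is a subsequence of $x_1\cdots x_n$, so a wall shuffle $\sigma_W$ is obtained as the subsequence of $x_1\cdots x_n$ consisting of all numbers occurring in these two sequences. Then $\gamma(x)$ is the generic rectangulation determined by $R'=\rho(x)$ and these wall shuffles. *)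

(* Defs.v *)
From HB Require Import structures.
From mathcomp Require Import all_boot all_order all_fingroup all_algebra.
From Stdlib Require Import Relations.
Set Implicit Arguments.
Unset Strict Implicit.
Unset Printing Implicit Defensive.
Import Order.TTheory GRing.Theory Num.Theory.

(* Positions and values of a permutation x : 'S_n are counted from 0, so
   x i = k stands for x_{i+1} = k+1, and tile k is the rectangle numbered k+1. *)

Section Permutations.
Variable n : nat.
Implicit Types (x y : 'S_n) (i j v : 'I_n) (C : {set 'I_n}).
Local Open Scope nat_scope.

Definition one_line x : seq 'I_n := [seq x i | i <- enum 'I_n].

(* The value v occurs in x before position i. *)
Definition on_left x i v : bool := ((x^-1)%g v < i).

(* x is covered by y in the weak order, the entries in positions i and j = i + 1
   of y being swapped to obtain x. *)
Definition weak_cover_at x y i j : Prop :=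
  [/\ j = i.+1 :> nat, y j < y i, x i = y j, x j = y i &
      forall k, k != i -> k != j -> x k = y k].

Definition Gamma_cover x y : Prop :=
  exists i j, weak_cover_at x y i j /\
    exists b c d : 'I_n,
      [/\ [/\ y j < b, b < c, c < d & d < y i],
          on_left y i b = on_left y i d &
          on_left y i c != on_left y i b].

(* The classes of a congruence on a finite lattice are intervals, so the congruence
   is generated, as an equivalence relation, by the covers that it identifies. *)
Definition Gamma : 'S_n -> 'S_n -> Prop := clos_refl_sym_trans 'S_n Gamma_cover.

(* Nonempty sets of consecutive values strictly between x_j and x_i, where
   j = i + 1, all lying on the same side of the entries x_i x_j. *)
Definition same_side_run x i j C : bool :=
  [&& C != set0,
      [forall u in C, x j < u < x i],
      [forall u in C, forall w in C, forall v : 'I_n, (u < v < w) ==> (v \in C)] &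
      [forall u in C, forall w in C, on_left x i u == on_left x i w]].

Definition clumps x i j : {set {set 'I_n}} :=
  [set C | maxset (same_side_run x i j) C].

Definition two_clumped x : Prop :=
  forall i j, j = i.+1 :> nat -> x j < x i -> #|clumps x i j| <= 2.

End Permutations.

Record rect (T : Type) := Rect { lft : T; rgt : T; bot : T; top : T }.

(* The construction of rho, with S = [0, n] x [0, n] and diagonal points
   (k, n - k) for 0 <= k <= n: label k is the space between (k, n - k) and
   (k + 1, n - k - 1).  Every corner produced is a point of the integer grid, so
   T is recorded through its grid points only. *)
Section Rho.
Variable n : nat.
Local Open Scope nat_scope.

Definition in_T (drawn : seq (rect nat)) (a b : nat) : bool :=
  [|| a == 0, b == 0 |
      has (fun r => (lft r <= a <= rgt r) && (bot r <= b <= top r)) drawn].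

Definition top_left_corner (drawn : seq (rect nat)) (k : nat) : nat * nat :=
  if in_T drawn k (n - k)
  then (k, \max_(n - k <= b < n.+1 | in_T drawn k b) b)
  else (\max_(0 <= a < k | in_T drawn a (n - k)) a, n - k).

Definition bottom_right_corner (drawn : seq (rect nat)) (k : nat) : nat * nat :=
  if in_T drawn k.+1 (n - k.+1)
  then (\max_(k.+1 <= a < n.+1 | in_T drawn a (n - k.+1)) a, n - k.+1)
  else (k.+1, \max_(0 <= b < n - k.+1 | in_T drawn k.+1 b) b).

Definition next_rect (drawn : seq (rect nat)) (k : nat) : rect nat :=
  let tl := top_left_corner drawn k in
  let br := bottom_right_corner drawn k in
  Rect tl.1 br.1 br.2 tl.2.

Definition draw (labels : seq 'I_n) : seq (rect nat) :=
  foldl (fun drawn (k : 'I_n) => rcons drawn (next_rect drawn k)) [::] labels.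

Definition rho_rect (x : 'S_n) (k : 'I_n) : rect nat :=
  nth (Rect 0 0 0 0) (draw (one_line x)) ((x^-1)%g k).

End Rho.

From mathcomp Require Import boolp classical_sets reals.
Local Open Scope classical_set_scope.
Local Open Scope ring_scope.

Section Rectangulations.
Variable R : realType.

(* The points (axis_coord, t) if vertical, (t, axis_coord) otherwise, lo <= t <= hi. *)
Record segment := Segment { vertical : bool; axis_coord : R; lo : R; hi : R }.

Definition seg_point (W : segment) (t : R) : R * R :=
  if vertical W then (axis_coord W, t) else (t, axis_coord W).

Definition seg_points (W : segment) : set (R * R) :=
  [set seg_point W t | t in [set t | lo W <= t <= hi W]].

Definition lo_end (W : segment) : R * R := seg_point W (lo W).
Definition hi_end (W : segment) : R * R := seg_point W (hi W).

Definition rect_points (r : rect R) : set (R * R) :=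
  [set p | lft r <= p.1 <= rgt r /\ bot r <= p.2 <= top r].

Definition rect_interior (r : rect R) : set (R * R) :=
  [set p | lft r < p.1 < rgt r /\ bot r < p.2 < top r].

Definition is_corner (p : R * R) (r : rect R) : bool :=
  ((p.1 == lft r) || (p.1 == rgt r)) && ((p.2 == bot r) || (p.2 == top r)).

(* lo_edge v / hi_edge v: left / right edge if v, bottom / top edge if ~~ v. *)
Definition lo_edge (v : bool) (r : rect R) : segment :=
  if v then Segment true (lft r) (bot r) (top r)
  else Segment false (bot r) (lft r) (rgt r).

Definition hi_edge (v : bool) (r : rect R) : segment :=
  if v then Segment true (rgt r) (bot r) (top r)
  else Segment false (top r) (lft r) (rgt r).

Variable n : nat.

Record layout := Layout { frame : rect R; tile : 'I_n -> rect R }.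

Implicit Types (L M : layout) (W : segment) (x : 'S_n).

Definition is_tiling L : Prop :=
  [/\ forall i, lft (tile L i) < rgt (tile L i) /\ bot (tile L i) < top (tile L i),
      \bigcup_(i in [set: 'I_n]) rect_points (tile L i) = rect_points (frame L) &
      forall i j, i != j ->
        rect_interior (tile L i) `&` rect_interior (tile L j) = set0].

Definition is_generic L : Prop :=
  forall p, (#|[pred i | is_corner p (tile L i)]| < 4)%N.

Definition generic_tiling L : Prop := is_tiling L /\ is_generic L.

(* adjacent true is "left of", adjacent false is "below". *)
Definition adjacent (v : bool) L (i j : 'I_n) : Prop :=
  seg_points (hi_edge v (tile L i)) `&` seg_points (lo_edge v (tile L j)) !=set0.

Definition left_of := adjacent true.
Definition below := adjacent false.

Definition comb_equiv L M : Prop :=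
  exists s : 'S_n, forall i j,
    (below M (s i) (s j) <-> below L i j) /\
    (left_of M (s i) (s j) <-> left_of L i j).

(* Generic rectangulations with n rectangles, as classes of generic tilings. *)
Definition gRec : set (set layout) :=
  [set C | exists2 L, generic_tiling L &
             C = [set M | generic_tiling M /\ comb_equiv L M]].

Definition avoids_interiors L W : Prop :=
  seg_points W `<=` rect_points (frame L) /\
  forall i, seg_points W `&` rect_interior (tile L i) = set0.

Definition is_wall L W : Prop :=
  [/\ lo W < hi W,
      avoids_interiors L W,
      forall v, ~ seg_points W `<=` seg_points (lo_edge v (frame L)) /\
                ~ seg_points W `<=` seg_points (hi_edge v (frame L)) &
      forall W', avoids_interiors L W' -> seg_points W `<=` seg_points W' ->
                 seg_points W' `<=` seg_points W].

(* W' is a wall that ends at W from the left or from below ... *)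
Definition ends_from_lo L W' W : Prop :=
  [/\ is_wall L W', vertical W' = ~~ vertical W & seg_points W (hi_end W')].

(* ... or from the right or from above. *)
Definition ends_from_hi L W' W : Prop :=
  [/\ is_wall L W', vertical W' = ~~ vertical W & seg_points W (lo_end W')].

(* W a vertical wall with W1 ending at W on the left and W2 on the right:
     U is the tile with right edge in W and bottom edge in W1,
     D is the tile with right edge in W and top edge in W1,
     A is the tile with left edge in W and bottom edge in W2,
     B is the tile with left edge in W and top edge in W2,
   and no wall ends at W between W1 and W2.  When W1 moves from below W2 to above
   W2, U stops being left of B, D becomes left of A, and nothing else changes.
   For W horizontal, exchange the two coordinates.  The move in the opposite
   direction is the inverse relation. *)
Definition wall_slide_up L M : Prop :=
  exists W W1 W2 (U D A B : 'I_n),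
    let v := vertical W in
    [/\ [/\ is_wall L W, ends_from_lo L W1 W & ends_from_hi L W2 W],
        axis_coord W1 < axis_coord W2 /\
        (forall W', ends_from_lo L W' W \/ ends_from_hi L W' W ->
           ~ (axis_coord W1 < axis_coord W' < axis_coord W2)),
        [/\ seg_points (hi_edge v (tile L U)) `<=` seg_points W,
            seg_points (lo_edge (~~ v) (tile L U)) `<=` seg_points W1,
            seg_points (hi_edge v (tile L D)) `<=` seg_points W &
            seg_points (hi_edge (~~ v) (tile L D)) `<=` seg_points W1],
        [/\ seg_points (lo_edge v (tile L A)) `<=` seg_points W,
            seg_points (lo_edge (~~ v) (tile L A)) `<=` seg_points W2,
            seg_points (lo_edge v (tile L B)) `<=` seg_points W &
            seg_points (hi_edge (~~ v) (tile L B)) `<=` seg_points W2] &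
        (forall i j, adjacent (~~ v) M i j <-> adjacent (~~ v) L i j) /\
        (forall i j, adjacent v M i j <->
           (adjacent v L i j /\ (i, j) <> (U, B)) \/ (i, j) = (D, A))].

Definition same_adjacencies L M : Prop :=
  forall v i j, adjacent v M i j <-> adjacent v L i j.

(* Equivalence as mosaic floorplans for tilings whose tiles are numbered, the
   numbers being carried along by the wall slides. *)
Definition mosaic_step L M : Prop :=
  [/\ generic_tiling L, generic_tiling M &
      same_adjacencies L M \/ wall_slide_up L M].

Definition mosaic_equiv : layout -> layout -> Prop :=
  clos_refl_sym_trans layout mosaic_step.

(* (c, k): at position c along W, the number k is recorded in the wall shuffle. *)
Definition recorded L W (e : R * 'I_n) : Prop :=
  let v := vertical W in
  exists2 W', axis_coord W' = e.1 &
    [/\ ends_from_lo L W' W,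
        seg_points (hi_edge v (tile L e.2)) `<=` seg_points W &
        seg_points (lo_edge (~~ v) (tile L e.2)) `<=` seg_points W'] \/
    [/\ ends_from_hi L W' W,
        seg_points (lo_edge v (tile L e.2)) `<=` seg_points W &
        seg_points (hi_edge (~~ v) (tile L e.2)) `<=` seg_points W'].

Definition is_wall_shuffle L W (s : seq 'I_n) : Prop :=
  exists es : seq (R * 'I_n),
    [/\ sorted (fun e f => e.1 < f.1) es,
        forall e, e \in es <-> recorded L W e &
        s = [seq e.2 | e <- es]].

Definition subword x L W : seq 'I_n :=
  [seq k <- one_line x | `[< exists c, recorded L W (c, k) >]].

Definition rho x : layout :=
  Layout (Rect 0 n%:R 0 n%:R)
    (fun k => let r := rho_rect x k in
              Rect (lft r)%:R (rgt r)%:R (bot r)%:R (top r)%:R).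

(* L is numbered by its mosaic equivalence with the diagonal rectangulation
   rho x.  The set of numbers to be shuffled along a wall of rho x is the same as
   for the corresponding wall of L. *)
Definition determined_by x L : Prop :=
  [/\ generic_tiling L, mosaic_equiv (rho x) L &
      forall W, is_wall L W -> is_wall_shuffle L W (subword x L W)].

Definition renumber (s : 'S_n) L : layout :=
  Layout (frame L) (fun k => tile L (s k)).

(* The generic rectangulation gamma x, as the class of its representative
   tilings; s is the numbering of the tiles of L inherited from rho x. *)
Definition gamma x : set layout :=
  [set L | exists s : 'S_n, determined_by x (renumber s L)].

End Rectangulations.

(* Main.v *)
Require Import Defs.
From mathcomp Require Import all_boot all_order all_fingroup all_algebra.
From mathcomp Require Import boolp classical_sets reals.
From mathcomp Require Import zify lra.
From Stdlib Require Import Relations.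
Set Implicit Arguments.
Unset Strict Implicit.
Unset Printing Implicit Defensive.
Import Order.TTheory GRing.Theory Num.Theory.

(* The tiles of rho x have explicit coordinates: measured from the left and from the
   top, tile k spans [1 + max {j < k | j before k}, min {j > k | j after k}]
   horizontally and [1 + max {j < k | j after k}, min {j > k | j before k}]
   vertically, where "before" refers to the positions in x, the empty maximum is 0
   with the summand 1 dropped, and the empty minimum is n.

   Call an upper and a lower (or a right and a left) edge of two tiles related if the
   tiles are adjacent along them.  In a generic tiling the classes of the equivalence
   relation generated by this are the walls, and a wall slide does not change the
   equivalence relation.  Hence it can be computed in rho x, where two edges are
   related exactly when they lie on the same grid line inside the square.

   If y covers x and the swapped entries a < e have at least three clumps between
   them, the formulas give rho x = rho y, and no edge of a is on the same line as a
   parallel edge of e, so that no wall shuffle of a tiling equivalent to rho x can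
   tell x from y.  Conversely, let a tiling be determined by both x and y, and let
   a < e be adjacent in x but in the opposite order in y.  If there is at most one
   clump between a and e, their order can be read off rho x; if there are two, both
   are recorded on a common wall.  Thus there are at least three, and swapping a and
   e is a step of Gamma that brings x closer to y.

   Removing descents with at least three clumps is a terminating and locally
   confluent rewriting system, whose normal forms are the 2-clumped permutations. *)

(** * The coordinates of the tiles of rho x *)

Section Positions.
Variable n : nat.
Implicit Types (x : 'S_n) (s : seq 'I_n) (r : rect nat).
Local Open Scope nat_scope.

(** Labels are natural numbers here, so that they can be compared with the coordinates [0] to [n]; a
    label out of range gets the position [n], after all entries. *)
Definition posn x (k : nat) : nat :=
  if insub k is Some v then (x^-1)%g v else n.

Lemma posn_ord x (v : 'I_n) : posn x v = (x^-1)%g v.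
Proof. by rewrite /posn valK. Qed.

Lemma posn_lt x k : k < n -> posn x k < n.
Proof. by move=> kn; rewrite -[k]/(val (Ordinal kn)) posn_ord. Qed.

Lemma posn_inj x i j : i < n -> j < n -> posn x i = posn x j -> i = j.
Proof.
move=> ilt jlt; rewrite -[i]/(val (Ordinal ilt)) -[j]/(val (Ordinal jlt)) !posn_ord.
by move=> /val_inj /perm_inj ->.
Qed.

(** The flag reverses time: formulas for horizontal coordinates ([v = true]) become those for
    vertical coordinates when before and after are exchanged. *)
Definition bef x (v : bool) (i j : nat) : bool :=
  if v then posn x i < posn x j else posn x j < posn x i.

(** [X] is the least label above [k] that [k] precedes in the sense of [bef], with default [n]; for
    [is_low] it is one more than the largest label below [k] that precedes [k], with default [0]. *)
Definition is_upp x v k X :=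
  [/\ k < X <= n, X < n -> bef x v k X & forall j, k < j < X -> ~~ bef x v k j].

Definition is_low x v k X :=
  [/\ X <= k, 0 < X -> bef x v X.-1 k & forall j, X <= j < k -> ~~ bef x v j k].

(** Heights are measured from the top, so that both directions use the same two predicates; hence
    [top r] gives the low coordinate and [bot r] the upper one. *)
Definition rho_spec x k r :=
  [/\ is_low x true k (lft r), is_upp x true k (rgt r),
      top r <= n /\ is_low x false k (n - top r) &
      bot r <= n /\ is_upp x false k (n - bot r)].

Lemma is_upp_inj x v k X Y : is_upp x v k X -> is_upp x v k Y -> X = Y.
Proof.
move=> [h1 h2 h3] [g1 g2 g3]; case: (ltngtP X Y) => // lt.
- by have := g3 X; rewrite h2 ?lt ?andbT; lia.
- by have := h3 Y; rewrite g2 ?lt ?andbT; lia.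
Qed.

Lemma is_low_inj x v k X Y : is_low x v k X -> is_low x v k Y -> X = Y.
Proof.
move=> [h1 h2 h3] [g1 g2 g3]; case: (ltngtP X Y) => // lt.
- by have := h3 Y.-1; rewrite g2; lia.
- by have := g3 X.-1; rewrite h2; lia.
Qed.

(** An empty maximum is [0]. The witness [b0] makes the maximum genuine: if its value is [0], then
    [b0 = 0] attains it. *)
Lemma bigmax_nat_attained m N (P : pred nat) b0 :
  m <= b0 < N -> P b0 ->
  let M := \max_(m <= b < N | P b) b in
  [/\ m <= M < N, P M & forall b, m <= b < N -> P b -> b <= M].
Proof.
move=> hb0 Pb0 M.
have ub b : m <= b < N -> P b -> b <= M.
  by move=> hb Pb; rewrite /M (@leq_bigmax_seq _ _ P id) // mem_index_iota.
have : b0 <= M by apply: ub.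
have [] : M = 0 \/ (m <= M < N /\ P M).
  rewrite /M big_seq_cond.
  elim/big_ind: _ => [|a b [->|ha] [->|hb]|i]; rewrite ?maxn0 ?max0n; auto.
    by right; case: (leqP a b) => _.
  by rewrite mem_index_iota => /andP[? ?]; right.
- move=> M0 h; have b00 : b0 = 0 by lia.
  by subst b0; rewrite M0; split => //; move=> b; rewrite -M0; apply: ub.
- by move=> [? ?] _; split.
Qed.

Lemma exists_last x (A : pred nat) i0 : i0 < n -> A i0 ->
  exists i, [/\ i < n, A i & forall j, j < n -> A j -> posn x j <= posn x i].
Proof.
move=> hi0 Ai0.
case: (@arg_maxnP _ (Ordinal hi0) (fun i : 'I_n => A i) (fun i : 'I_n => posn x i)) => // i Ai H.
by exists i; split=> // j jn Aj; apply: (H (Ordinal jn)).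
Qed.

Lemma exists_first x (A : pred nat) i0 : i0 < n -> A i0 ->
  exists i, [/\ i < n, A i & forall j, j < n -> A j -> posn x i <= posn x j].
Proof.
move=> hi0 Ai0.
case: (@arg_minnP _ (Ordinal hi0) (fun i : 'I_n => A i) (fun i : 'I_n => posn x i)) => // i Ai H.
by exists i; split=> // j jn Aj; apply: (H (Ordinal jn)).
Qed.

Lemma exists_extremal x (v : bool) (A : pred nat) i0 : i0 < n -> A i0 ->
  exists i, [/\ i < n, A i & forall j, j < n -> A j -> j != i -> bef x v j i].
Proof.
move=> hi0 Ai0; case: v.
- have [i [hi Ai H]] := exists_last x hi0 Ai0; exists i; split => // j jn Aj ne.
  rewrite /bef ltn_neqAle H // andbT; apply: contra ne => /eqP /posn_inj ->; by rewrite ?eqxx.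
- have [i [hi Ai H]] := exists_first x hi0 Ai0; exists i; split => // j jn Aj ne.
  rewrite /bef ltn_neqAle H // andbT; apply: contra ne => /eqP /posn_inj ->; by rewrite ?eqxx.
Qed.

Lemma is_lowP x v k X a : is_low x v k X ->
  reflect (forall i, a <= i < k -> ~~ bef x v i k) (X <= a).
Proof.
move=> [h1 h2 h3]; apply: (iffP idP) => [le i hi|H]; first by apply: h3; lia.
by case: leqP => // lt; have := H X.-1; rewrite h2; lia.
Qed.

Lemma is_uppP x v k X a : is_upp x v k X -> a <= n ->
  reflect (forall i, k < i < a -> ~~ bef x v k i) (a <= X).
Proof.
move=> [h1 h2 h3] an; apply: (iffP idP) => [le i hi|H]; first by apply: h3; lia.
by case: leqP => // lt; have := H X; rewrite h2; lia.
Qed.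

(** Membership of the grid point at distance [a] from the left and [Y] from the top in the closed
    tile [j]; each condition expresses one of the four bounds through positions. *)
Definition covers x j a Y :=
  [/\ forall i, a <= i < j -> posn x j <= posn x i,
      forall i, j < i < a -> posn x i <= posn x j,
      forall i, Y <= i < j -> posn x i <= posn x j &
      forall i, j < i < Y -> posn x j <= posn x i].

Lemma rho_spec_covers x j r a Y : a <= n -> Y <= n -> rho_spec x j r ->
  reflect (covers x j a Y)
    ((lft r <= a <= rgt r) && (bot r <= n - Y <= top r)).
Proof.
move=> an Yn [lt ut [tn lf] [bn uf]].
have -> : (bot r <= n - Y <= top r) = (Y <= n - bot r) && (n - top r <= Y) by lia.
apply: (iffP idP).
- move=> /andP[/andP[/(is_lowP _ lt) h1 /(is_uppP ut an) h2]].
  move=> /andP[/(is_uppP uf Yn) h4 /(is_lowP _ lf) h3].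
  by split=> i hi; move: (h1 i) (h2 i) (h3 i) (h4 i); rewrite /bef; lia.
- move=> [h1 h2 h3 h4]; apply/andP; split; apply/andP; split.
  + by apply/(is_lowP _ lt) => i /h1; rewrite /bef; lia.
  + by apply/(is_uppP ut an) => i /h2; rewrite /bef; lia.
  + by apply/(is_uppP uf Yn) => i /h4; rewrite /bef; lia.
  + by apply/(is_lowP _ lf) => i /h3; rewrite /bef; lia.
Qed.

Lemma posn_onto x m : m < n -> exists2 j, j < n & posn x j = m.
Proof.
move=> mn; exists (x (Ordinal mn)) => //.
by rewrite (posn_ord x (x (Ordinal mn))) permK.
Qed.

Lemma last_in_range x lo hi : lo <= hi -> hi < n ->
  exists2 j, lo <= j <= hi & forall i, lo <= i <= hi -> posn x i <= posn x j.
Proof.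
move=> lh hn.
have [||j [jn Aj H]] := @exists_last x (fun i => lo <= i <= hi) lo; try lia.
by exists j => // i hi'; apply: H; lia.
Qed.

(** * One drawing step, given the tiles of all earlier entries *)

Section NextRect.
Variables (x : 'S_n) (drawn : seq (rect nat)) (k : nat).
Hypothesis kn : k < n.
Hypothesis size_drawn : size drawn = posn x k.
Hypothesis drawn_spec : forall j, j < n -> posn x j < posn x k ->
  rho_spec x j (nth (Rect 0 0 0 0) drawn (posn x j)).

Lemma in_TP a b : a <= n -> b <= n ->
  reflect [\/ a = 0, b = 0 |
    exists2 j, j < n /\ posn x j < posn x k & covers x j a (n - b)]
  (in_T drawn a b).
Proof.
move=> an bn; rewrite /in_T; apply: (iffP or3P).
- case=> [/eqP ?|/eqP ?|]; [by apply: Or31|by apply: Or32|].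
  move=> /(has_nthP (Rect 0 0 0 0))[i]; rewrite size_drawn => ik.
  have [|j jn ji] := @posn_onto x i; first by have := posn_lt x kn; lia.
  rewrite -ji in ik *; move=> H; apply: Or33; exists j => //.
  apply/(rho_spec_covers an (leq_subr _ _) (drawn_spec jn ik)).
  by rewrite subKn.
- case=> [->|->|[j [jn jk]]]; [by apply: Or31|by apply: Or32|].
  move=> /(rho_spec_covers an (leq_subr _ _) (drawn_spec jn jk)) H; apply: Or33.
  apply/(has_nthP (Rect 0 0 0 0)); exists (posn x j); first by rewrite size_drawn.
  by move: H; rewrite subKn.
Qed.

(** Only the two labels beside a diagonal point have tiles through it: for any other tile, one of
    these two labels would have to come both before and after the label of the tile. As [k] is not
    drawn yet, [k.-1] remains. *)
Lemma top_left_in_T : in_T drawn k (n - k) -> k = 0 \/ posn x k.-1 < posn x k.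
Proof.
move=> /in_TP[||k0|e|[j [jn jk]]]; try lia; rewrite subKn; last lia.
move=> [h1 h2 h3 h4]; have jnk : j != k by apply: contraTneq jk => ->; lia.
have := h3 k; have := h2 k.-1; have := h4 k.-1; have := @posn_inj x j k.-1.
by case: (ltngtP j k.-1) => [?|?|<-]; lia.
Qed.

Lemma top_left_notin_T : ~~ in_T drawn k (n - k) -> 0 < k /\ posn x k < posn x k.-1.
Proof.
move=> H; have k0 : 0 < k by case: k H => // H; rewrite /in_T eqxx in H.
split=> //; have := @posn_inj x k k.-1; suff : ~ posn x k.-1 < posn x k by lia.
move=> lt; apply: (negP H); apply/in_TP; try lia; apply: Or33; exists k.-1; first by split; lia.
by rewrite subKn; last lia; split => i; lia.
Qed.

(** If the diagonal point lies in [T], the left side is at [k] and the maximum gives the top;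
    otherwise the top is at height [n - k] and the maximum gives the left side. Maximality is used
    through a drawn tile that would cover a further grid point. *)
Lemma top_left_spec : let tl := top_left_corner n drawn k in
  is_low x true k tl.1 /\ tl.2 <= n /\ is_low x false k (n - tl.2).
Proof.
rewrite /top_left_corner; case: ifPn => kT /=.
- have kT' := top_left_in_T kT.
  split; first by split=> //; rewrite /bef; lia.
  have [|] := @bigmax_nat_attained (n - k) n.+1 (in_T drawn k) (n - k) _ kT; first lia.
  set M := \max_(_ <= _ < _ | _) _; move=> hM MT Mmax.
  split; first lia; have XT j : n - M <= j < k -> posn x j < posn x k.
    move=> hj; have := MT; move/in_TP => -[||k0|e|[i [ilt ik]]]; try lia.
    move=> [h1 h2 h3 h4]; have ink : i != k by apply: contraTneq ik => ->; lia.
    have := h2 j; have := h3 j; have := h3 k.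
    by case: (ltngtP i j) => [?|?|<-]; lia.
  split; first lia.
  - move=> X0; rewrite /bef; have := @posn_inj x k (n - M).-1.
    suff : ~ posn x (n - M).-1 < posn x k by lia.
    (* If this label came before [k] as well, the tile of the last drawn label in the range would
       contain [(k, M + 1)]. *)
    move=> lt; have [||j hj jmax] := @last_in_range x (n - M).-1 k.-1; try lia.
    have XT' i : (n - M).-1 <= i < k -> posn x i < posn x k.
      move=> hi; case: (leqP (n - M) i) => ?; first by apply: XT; lia.
      by have -> : i = (n - M).-1 by lia.
    have jk := XT' j; suff : M.+1 <= M by lia.
    apply: Mmax; first lia; apply/in_TP; try lia; apply: Or33; exists j; first by split; lia.
    have -> : n - M.+1 = (n - M).-1 by lia.
    by split=> i hi; try lia; apply: jmax; lia.
  - by move=> j hj; have := XT j hj; rewrite /bef; lia.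
- have [k0 kk1] := top_left_notin_T kT.
  rewrite subKn; last lia; split; last first.
    by split; [lia | split=> //; rewrite /bef; lia].
  have [||] := @bigmax_nat_attained 0 k (fun a => in_T drawn a (n - k)) 0; try lia.
    by rewrite /in_T eqxx.
  set M := \max_(_ <= _ < _ | _) _; move=> hM MT Mmax.
  (* If [i] is drawn before [k] and all labels between them come after [k], the tile of [i] contains
     [(i + 1, n - k)]. *)
  have step i : i < k -> posn x i < posn x k ->
      (forall j, i < j < k -> posn x k < posn x j) -> i < M.
    move=> hi ik H; have : i != k.-1 by apply: contraTneq ik => ->; lia.
    move=> ik1; apply: Mmax; first lia; apply/in_TP; try lia.
    apply: Or33; exists i; first by split; lia.
    rewrite subKn; last lia.
    by split=> j hj; try lia; have := H j; lia.
  (* Induction on the distance to [k]: the violating label nearest to [k] would satisfy the premises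
     of [step]. *)
  have XT j : M <= j < k -> posn x k < posn x j.
    have [m] := ubnP (k - j); elim: m j => // m IH j hm hj.
    have := @posn_inj x k j; suff : ~ posn x j < posn x k by lia.
    move=> jk; suff : j < M by lia.
    by apply: step => // [|i hi]; [lia | apply: IH; lia].
  split; first lia.
  - move=> M0; rewrite /bef; have := MT; move/in_TP => -[||?|e|[j [jn jk]]]; try lia.
    rewrite subKn; last lia; move=> [h1 h2 h3 h4].
    have jnk : j != k by apply: contraTneq jk => ->; lia.
    have jk' : j < k by have := h3 k; lia.
    have jM : j < M.
      by apply: step => // i hi; have := @posn_inj x i k; have := XT i; have := h2 i;
         have := h4 i; have := @posn_inj x i j; lia.
    have := h2 M.-1; have := h4 M.-1; have := @posn_inj x j M.-1.
    by case: (ltngtP j M.-1) => [?|?|<-]; lia.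
  - by move=> j hj; have := XT j hj; rewrite /bef; lia.
Qed.

Lemma bottom_right_in_T : in_T drawn k.+1 (n - k.+1) ->
  k.+1 < n -> posn x k.+1 < posn x k.
Proof.
move=> kT k1n; move: kT => /in_TP[||e|?|[j [jn jk]]]; try lia; rewrite subKn //.
move=> [h1 h2 h3 h4]; have jnk : j != k by apply: contraTneq jk => ->; lia.
have := h2 k; have := h1 k.+1; have := h3 k.+1; have := @posn_inj x j k.+1.
by case: (ltngtP j k.+1) => [?|?|<-]; lia.
Qed.

Lemma bottom_right_notin_T : ~~ in_T drawn k.+1 (n - k.+1) ->
  k.+1 < n /\ posn x k < posn x k.+1.
Proof.
move=> H; have k1n : k.+1 < n.
  by rewrite ltn_neqAle kn andbT; apply: contra H => /eqP <-; rewrite /in_T subnn eqxx orbT.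
split=> //; have := @posn_inj x k k.+1; suff : ~ posn x k.+1 < posn x k by lia.
move=> lt; apply: (negP H); apply/in_TP; try lia; apply: Or33; exists k.+1; first by split; lia.
by rewrite subKn; last lia; split => i; lia.
Qed.

(** The same two cases with the labels above [k]: the maximum gives the right side if the diagonal
    point lies in [T], and the bottom otherwise. *)
Lemma bottom_right_spec : let br := bottom_right_corner n drawn k in
  is_upp x true k br.1 /\ br.2 <= n /\ is_upp x false k (n - br.2).
Proof.
rewrite /bottom_right_corner; case: ifPn => kT /=.
- have kT' := bottom_right_in_T kT.
  rewrite subKn //; split; last first.
    by split; [lia | split; [lia | rewrite /bef; lia | move=> j; lia]].
  have [|] := @bigmax_nat_attained k.+1 n.+1 (fun a => in_T drawn a (n - k.+1)) k.+1 _ kT;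
    first lia.
  set M := \max_(_ <= _ < _ | _) _; move=> hM MT Mmax.
  have XT j : k < j < M -> posn x j < posn x k.
    move=> hj; have := MT; move/in_TP => -[||?|e|[i [ilt ik]]]; try lia.
    rewrite subKn //; move=> [h1 h2 h3 h4].
    have ink : i != k by apply: contraTneq ik => ->; lia.
    have := h2 j; have := h3 j; have := h2 k.
    by case: (ltngtP i j) => [?|?|<-]; lia.
  split; first lia.
  - move=> Mn; rewrite /bef; have := @posn_inj x k M.
    suff : ~ posn x M < posn x k by lia.
    move=> lt; have [||j hj jmax] := @last_in_range x k.+1 M; try lia.
    have XT' i : k < i <= M -> posn x i < posn x k.
      move=> hi; case: (ltnP i M) => ?; first by apply: XT; lia.
      by have -> : i = M by lia.
    have jk := XT' j; suff : M.+1 <= M by lia.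
    apply: Mmax; first lia; apply/in_TP; try lia; apply: Or33; exists j; first by split; lia.
    by rewrite subKn //; split=> i hi; try lia; apply: jmax; lia.
  - by move=> j hj; have := XT j hj; rewrite /bef; lia.
- have [k1n kk1] := bottom_right_notin_T kT.
  split; first by split=> //; [lia | rewrite /bef; lia].
  have [||] := @bigmax_nat_attained 0 (n - k.+1) (in_T drawn k.+1) 0; try lia.
    by rewrite /in_T eqxx orbT.
  set M := \max_(_ <= _ < _ | _) _; move=> hM MT Mmax.
  split; first lia.
  have step i : k < i < n -> posn x i < posn x k ->
      (forall j, k < j < i -> posn x k < posn x j) -> n - M <= i.
    move=> hi ik H; have : i != k.+1 by apply: contraTneq ik => ->; lia.
    move=> ik1; suff : n - i <= M by lia.
    apply: Mmax; first lia; apply/in_TP; try lia.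
    apply: Or33; exists i; first by split; lia.
    rewrite subKn; last lia.
    by split=> j hj; try lia; have := H j; lia.
  have XT j : k < j < n - M -> posn x k < posn x j.
    have [m] := ubnP j; elim: m j => // m IH j hm hj.
    have := @posn_inj x k j; suff : ~ posn x j < posn x k by lia.
    move=> jk; suff : n - M <= j by lia.
    by apply: step => // [|i hi]; [lia | apply: IH; lia].
  split; first lia.
  - move=> M0; rewrite /bef; have := MT; move/in_TP => -[||?|e|[j [jn jk]]]; try lia.
    move=> [h1 h2 h3 h4].
    have jnk : j != k by apply: contraTneq jk => ->; lia.
    have jk' : k < j by have := h2 k; lia.
    have jM : n - M <= j.
      by apply: step => //; [lia | move=> i hi; have := @posn_inj x i k; have := XT i;
         have := h1 i; have := h3 i; have := @posn_inj x i j; lia].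
    have := h1 (n - M); have := h3 (n - M); have := @posn_inj x j (n - M).
    by case: (ltngtP j (n - M)) => [?|?|<-]; lia.
  - by move=> j hj; have := XT j hj; rewrite /bef; lia.
Qed.

Lemma next_rect_spec : rho_spec x k (next_rect n drawn k).
Proof.
have [? [? ?]] := top_left_spec; have [? [? ?]] := bottom_right_spec.
by split.
Qed.

End NextRect.

Lemma size_draw s : size (draw s) = size s.
Proof.
by elim/last_ind: s => // s k IH; rewrite /draw foldl_rcons !size_rcons IH.
Qed.

(** Induction on the number of entries drawn: a step only appends a tile, which [next_rect_spec]
    describes. *)
Lemma draw_spec x m : m <= n -> forall j, j < n -> posn x j < m ->
  rho_spec x j (nth (Rect 0 0 0 0) (draw (take m (one_line x))) (posn x j)).
Proof.
have sz : size (one_line x) = n by rewrite size_map size_enum_ord.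
elim: m => [//|m IH] mn j jn; rewrite ltnS => jm.
have xm : nth (x (Ordinal mn)) (one_line x) m = x (Ordinal mn).
  by rewrite (nth_map (Ordinal mn)) ?size_enum_ord // (nth_ord_enum _ (Ordinal mn)).
rewrite (take_nth (x (Ordinal mn))) ?sz // xm /draw foldl_rcons -/(draw _).
rewrite nth_rcons size_draw size_takel ?sz; last lia.
case: ltngtP jm => // [jm _|jm _]; first by apply: IH => //; lia.
have pm : posn x (x (Ordinal mn)) = m by rewrite (posn_ord x (x (Ordinal mn))) permK.
have -> : j = x (Ordinal mn) by apply: (@posn_inj x) => //; rewrite jm pm.
apply: next_rect_spec => //; first by rewrite size_draw size_takel ?sz ?pm //; lia.
by move=> i hi; rewrite pm => im; apply: IH => //; lia.
Qed.

Lemma rho_rect_spec x (k : 'I_n) : rho_spec x k (rho_rect x k).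
Proof.
have := @draw_spec x n (leqnn n) k (ltn_ord k) (posn_lt x (ltn_ord k)).
by rewrite /rho_rect (posn_ord x k) take_oversize // size_map size_enum_ord.
Qed.

End Positions.

(** * Contracting descents with at least three clumps *)

Section Rewriting.
Variable n : nat.
Implicit Types (x y z t u w : 'S_n) (i j k : 'I_n).
Local Open Scope nat_scope.

(** The upper ends of the generating covers of [Gamma], located by position. The alternating values
    [b], [c], [d] witness three clumps. *)
Definition contractible y i j : Prop :=
  [/\ j = i.+1 :> nat, y j < y i & exists b c d : 'I_n,
      [/\ [/\ y j < b, b < c, c < d & d < y i],
          on_left y i b = on_left y i d &
          on_left y i c != on_left y i b]].

Definition swap y i j : 'S_n := (tperm i j * y)%g.

Lemma swapE y i j k : swap y i j k = y (tperm i j k).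
Proof. by rewrite permM. Qed.

Lemma swapL y i j : swap y i j i = y j.
Proof. by rewrite swapE tpermL. Qed.

Lemma swapR y i j : swap y i j j = y i.
Proof. by rewrite swapE tpermR. Qed.

Lemma swap_inv y i j v : ((swap y i j)^-1)%g v = tperm i j ((y^-1)%g v).
Proof. by rewrite invMg permM tpermV. Qed.

Lemma weak_cover_swap x y i j : weak_cover_at x y i j -> x = swap y i j.
Proof.
move=> [_ _ xi xj H]; apply/permP => k; rewrite swapE.
by case: tpermP => [->|->|/eqP ? /eqP ?] //; apply: H.
Qed.

Lemma swap_weak_cover y i j : j = i.+1 :> nat -> y j < y i ->
  weak_cover_at (swap y i j) y i j.
Proof.
move=> ji lt; split; rewrite ?swapL ?swapR // => k ki kj.
by rewrite swapE tpermD // eq_sym.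
Qed.

Lemma Gamma_coverP x y :
  Gamma_cover x y <-> exists i j, contractible y i j /\ x = swap y i j.
Proof.
split=> [[i [j [H P]]]|[i [j [[ji lt P] ->]]]].
- by exists i, j; split; [case: H => *; split | apply: weak_cover_swap].
- by exists i, j; split=> //; apply: swap_weak_cover.
Qed.

Lemma tperm_lt_sep i j i' j' (k : 'I_n) : j = i.+1 :> nat -> j' = i'.+1 :> nat ->
  i != i' -> j != i' -> i != j' -> (tperm i' j' k < i) = (k < i).
Proof.
move=> ji ji' /eqP h1 /eqP h2 /eqP h3.
have {}h1 : i <> i' :> nat by move=> /val_inj.
have {}h2 : j <> i' :> nat by move=> /val_inj.
have {}h3 : i <> j' :> nat by move=> /val_inj.
by case: tpermP => [->|->|_ _] //; lia.
Qed.

(** A swap at two other positions moves no entry across the pair, so the same [b], [c], [d]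
    serve. *)
Lemma contractible_swap_far y i j i' j' : j' = i'.+1 :> nat ->
  i != i' -> j != i' -> i != j' -> contractible y i j ->
  contractible (swap y i' j') i j.
Proof.
move=> ji' h1 h2 h3 [ji lt [b [c [d [hb s1 s2]]]]].
have h4 : j != j' by apply: contra h1 => /eqP jj; apply/eqP/ord_inj; rewrite jj in ji; lia.
have yi : swap y i' j' i = y i by rewrite swapE tpermD // eq_sym.
have yj : swap y i' j' j = y j by rewrite swapE tpermD // eq_sym.
split; rewrite ?yi ?yj //; exists b, c, d.
by split; rewrite ?yi ?yj // /on_left !swap_inv !(tperm_lt_sep _ ji ji').
Qed.

Lemma swap_far_comm y i j i' j' : i != i' -> j != i' -> i != j' -> j != j' ->
  swap (swap y i j) i' j' = swap (swap y i' j') i j.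
Proof.
move=> h1 h2 h3 h4; apply/permP => k; rewrite !swapE; congr (y _).
case: (tpermP i' j' k) => [->|->|/eqP n1 /eqP n2].
- by rewrite (tpermD h3 h4) (tpermD h1 h2) tpermL.
- by rewrite (tpermD h3 h4) (tpermD h1 h2) tpermR.
- by case: (tpermP i j k) => [_|_|_ _]; rewrite tpermD // eq_sym.
Qed.

Lemma swap_braid y i j k : i != j -> j != k -> i != k ->
  swap (swap (swap y i j) j k) i j = swap (swap (swap y j k) i j) j k.
Proof.
move=> ij jk ik; apply/permP => m; rewrite !swapE; congr (y _).
have ji : j != i by rewrite eq_sym. have kj : k != j by rewrite eq_sym.
have ki : k != i by rewrite eq_sym.
have E := (tpermL, tpermR, tpermD ik jk, tpermD ji ki).
have [->|mi] := eqVneq m i; first by rewrite !E.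
have [->|mj] := eqVneq m j; first by rewrite !E.
have [->|mk] := eqVneq m k; first by rewrite !E.
by rewrite !tpermD // eq_sym.
Qed.

Lemma contractible_swap_near y i j u (i' j' : 'I_n) :
  j' = i'.+1 :> nat -> u j' <= y j -> y i <= u i' ->
  contractible y i j ->
  (forall v : 'I_n, y j < v < y i -> on_left u i' v = on_left y i v) ->
  contractible u i' j'.
Proof.
move=> ji' le1 le2 [_ lt [b [c [d [[h1 h2 h3 h4] s1 s2]]]]] S.
split=> //; first by apply: leq_ltn_trans le1 (leq_trans lt le2).
exists b, c, d; split; first by split; lia.
- by rewrite !S //; lia.
- by rewrite !S //; lia.
Qed.

(** The entries [y i > y j > y k] span a hexagon in the weak order. Each remaining edge exchanges
    two values whose interval contains one of the two original intervals, and the witnesses inside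
    keep their sides. *)
Lemma contractible_hexagon y i j k : k = j.+1 :> nat ->
  contractible y i j -> contractible y j k ->
  [/\ contractible (swap y i j) j k,
      contractible (swap (swap y i j) j k) i j,
      contractible (swap y j k) i j &
      contractible (swap (swap y j k) i j) j k].
Proof.
move=> kj R1 R2; have [ji lt1 _] := R1; have [_ lt2 _] := R2.
have nij : i != j by apply/eqP => e; rewrite e in ji; lia.
have njk : j != k by apply/eqP => e; rewrite e in kj; lia.
have nik : i != k by apply/eqP => e; rewrite e in ji; lia.
have nji : j != i by rewrite eq_sym.
have nkj : k != j by rewrite eq_sym.
have nki : k != i by rewrite eq_sym.
have E := (swapE, tpermL, tpermR, tpermD nik njk, tpermD nji nki).
(* A value other than these three is fixed by the swaps and stands before or after all three
   positions. *)
have sides (v : 'I_n) : (v : nat) != y i -> (v : nat) != y j -> (v : nat) != y k ->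
   [/\ tperm i j ((y^-1)%g v) = (y^-1)%g v, tperm j k ((y^-1)%g v) = (y^-1)%g v,
     ((y^-1)%g v < i) = ((y^-1)%g v < j) &
     ((y^-1)%g v < j) = ((y^-1)%g v < k)].
  move=> vi vj vk.
  have pi : i != (y^-1)%g v by apply: contra vi => /eqP ->; rewrite permKV.
  have pj : j != (y^-1)%g v by apply: contra vj => /eqP ->; rewrite permKV.
  have pk : k != (y^-1)%g v by apply: contra vk => /eqP ->; rewrite permKV.
  rewrite !tpermD //; split=> //.
    suff : (j.-1 : nat) <> (y^-1)%g v by lia.
    by rewrite ji => /ord_inj /eqP; apply/negP.
  suff : (j : nat) <> (y^-1)%g v by lia.
  by move=> /ord_inj /eqP; apply/negP.
split.
- apply: (contractible_swap_near kj _ _ R1); rewrite ?E //; first lia.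
  move=> v hv; have [|||e1 e2 e3 e4] := sides v; try lia.
  by rewrite /on_left !swap_inv e1 e3.
- apply: (contractible_swap_near ji _ _ R2); rewrite ?E //.
  move=> v hv; have [|||e1 e2 e3 e4] := sides v; try lia.
  by rewrite /on_left !swap_inv e1 e2 e3.
- apply: (contractible_swap_near ji _ _ R2); rewrite ?E //; first lia.
  move=> v hv; have [|||e1 e2 e3 e4] := sides v; try lia.
  by rewrite /on_left !swap_inv e2 e3 ?e4.
- apply: (contractible_swap_near kj _ _ R1); rewrite ?E //.
  move=> v hv; have [|||e1 e2 e3 e4] := sides v; try lia.
  by rewrite /on_left !swap_inv e2 e1 e3.
Qed.

(** Rewriting goes down in the weak order, hence the exchanged arguments. *)
Definition steps := clos_refl_trans_1n 'S_n (fun y x => Gamma_cover x y).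

Lemma step_swap y i j : contractible y i j -> Gamma_cover (swap y i j) y.
Proof. by move=> R; apply/Gamma_coverP; exists i, j. Qed.

Lemma steps_cons y u z : Gamma_cover u y -> steps u z -> steps y z.
Proof.
move=> c S.
exact: (@Relation_Operators.rt1n_trans _ (fun y x => Gamma_cover x y) y u z c S).
Qed.

Lemma steps1 y i j : contractible y i j -> steps y (swap y i j).
Proof. by move=> R; apply: steps_cons (step_swap R) _; apply: rt1n_refl. Qed.

Lemma steps_trans y x z : steps y x -> steps x z -> steps y z.
Proof.
move=> S1 S2; apply: clos_rt_rt1n;
exact: (rt_trans _ _ _ _ _ (clos_rt1n_rt _ _ _ _ S1) (clos_rt1n_rt _ _ _ _ S2)).
Qed.

(** Overlapping descents are joined around the hexagon by the braid relation; disjoint ones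
    commute. *)
Lemma local_confluence_right y i j i' j' : i < i' ->
  contractible y i j -> contractible y i' j' ->
  exists2 t, steps (swap y i j) t & steps (swap y i' j') t.
Proof.
move=> ii' R R'; have [ji _ _] := R; have [ji' _ _] := R'.
have [e|ne] := eqVneq j i'.
- subst i'; have [S1 S2 S3 S4] := contractible_hexagon ji' R R'.
  exists (swap (swap (swap y i j) j j') i j).
    exact: steps_trans (steps1 S1) (steps1 S2).
  rewrite swap_braid; first exact: steps_trans (steps1 S3) (steps1 S4).
  + by apply/eqP => e; rewrite e in ji; lia.
  + by apply/eqP => e; rewrite e in ji'; lia.
  + by apply/eqP => e; rewrite e in ii'; lia.
- have h1 : i != i' by apply/eqP => e; rewrite e in ii'; lia.
  have h3 : i != j' by apply/eqP => e; rewrite e in ii'; lia.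
  have h4 : j != j' by apply: contra h1 => /eqP e; apply/eqP/ord_inj; rewrite e in ji; lia.
  exists (swap (swap y i j) i' j'); first apply: steps1.
    by apply: contractible_swap_far => //; rewrite eq_sym.
  by rewrite swap_far_comm //; apply/steps1/contractible_swap_far.
Qed.

Lemma local_confluence y x z : Gamma_cover x y -> Gamma_cover z y ->
  exists2 t, steps x t & steps z t.
Proof.
move=> /Gamma_coverP[i [j [R ->]]] /Gamma_coverP[i' [j' [R' ->]]].
case: (ltngtP i i') => [lt|lt|/ord_inj e].
- exact: local_confluence_right.
- by have [t ? ?] := local_confluence_right lt R' R; exists t.
- subst i'; exists (swap y i j); first exact: rt1n_refl.
  have -> : j = j' by apply: ord_inj; case: R R' => -> _ _ [].
  exact: rt1n_refl.
Qed.

(** For [z = 1] these pairs are the inversions of [x]. Their number serves both for termination of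
    the rewriting and as a distance between two permutations. *)
Definition discordant x z (p : 'I_n * 'I_n) : bool :=
  (posn x p.1 < posn x p.2) && (posn z p.2 < posn z p.1).

Definition disc x z : nat := #|[set p | discordant x z p]|.

(** Only the relative order of the swapped pair changes, and that pair ceases to be discordant. *)
Lemma disc_swap x z i j : j = i.+1 :> nat -> posn z (x j) < posn z (x i) ->
  disc (swap x i j) z < disc x z.
Proof.
move=> ji zji; apply: proper_card; apply/properP; split.
- apply/fintype.subsetP => -[u w]; rewrite !inE /discordant /= => /andP[lt ltz].
  rewrite ltz andbT; move: lt ltz.
  rewrite (posn_ord x) (posn_ord x) (posn_ord (swap x i j)) (posn_ord (swap x i j)) !swap_inv.
  move: (permKV x u) (permKV x w); move: ((x^-1)%g u) ((x^-1)%g w) => pu pw <- <-.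
  move: pu pw => {u w} u w.
  have neq (a b : 'I_n) : a <> b -> a <> b :> nat by move=> h /ord_inj.
  by case: tpermP => [->|->|/neq nui /neq nuj]; case: tpermP => [->|->|/neq nwi /neq nwj]; lia.
- exists (x i, x j); rewrite inE /discordant /= zji andbT
    (posn_ord _ (x i)) (posn_ord _ (x j)) ?swap_inv !permK ?tpermL ?tpermR; lia.
Qed.

Definition normal x := forall i j, ~ contractible x i j.

Lemma disc_contract y i j : contractible y i j -> disc (swap y i j) 1%g < disc y 1%g.
Proof.
move=> [ji lt _]; apply: disc_swap => //.
by rewrite !posn_ord invg1 !perm1.
Qed.

Lemma Gamma_cover_disc x y : Gamma_cover x y -> disc x 1%g < disc y 1%g.
Proof. by move=> /Gamma_coverP[i [j [R ->]]]; apply: disc_contract. Qed.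

Lemma normalize y : exists2 x, steps y x & normal x.
Proof.
have [m] := ubnP (disc y 1%g); elim: m y => // m IH y ym.
have [N|] := pselect (normal y); first by exists y => //; apply: rt1n_refl.
move=> /existsNP[i /existsNP[j /contrapT R]].
have [|x S N] := IH (swap y i j); first by have := disc_contract R; lia.
by exists x => //; apply: steps_trans (steps1 R) S.
Qed.

Lemma steps_normal x z : steps x z -> normal x -> z = x.
Proof. by case=> // u w /Gamma_coverP[i [j [R _]]] _ N; case: (N i j). Qed.

(* The inductive step of Newman's lemma, by induction on the discordance with the
   identity, which is the number of inversions. *)
Lemma normal_unique y x z :
  steps y x -> normal x -> steps y z -> normal z -> x = z.
Proof.
have [m] := ubnP (disc y 1%g); elim: m y x z => // m IH y x z ym S N S' N'.
case: S S' N => [|u w c S] S' N; first by rewrite (steps_normal S').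
case: S' N' => [|u' w' c' S'] N'.
  by case/Gamma_coverP: c => i [j [R _]]; case: (N' i j).
have [t T T'] := local_confluence c c'; have [t' S1 N1] := normalize t.
have lt := Gamma_cover_disc c; have lt' := Gamma_cover_disc c'.
have -> : w = t' by apply: (IH u) => //; [lia | apply: steps_trans S1].
by symmetry; apply: (IH u') => //; [lia | apply: steps_trans S1].
Qed.

Lemma steps_Gamma y x : steps y x -> Gamma x y.
Proof.
elim=> [u|u w t c _ IH]; first exact: rst_refl.
by apply: (rst_trans _ _ _ w) => //; apply: rst_step.
Qed.

(** Congruent permutations reach the same normal forms, by uniqueness from the upper end of each
    cover; a normal permutation reaches only itself. *)
Lemma Gamma_normal x y : Gamma x y -> normal x -> normal y -> x = y.
Proof.
have key u w : Gamma u w -> forall z, normal z -> (steps u z <-> steps w z).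
  elim=> {u w} [u w c z Nz|//|u w _ IH z Nz|u t w _ IH1 _ IH2 z Nz].
  - have S1 : steps w u by apply: steps_cons c _; apply: rt1n_refl.
    split=> S; first exact: steps_trans S1 S.
    have [t T Nt] := normalize u.
    by have <- : t = z by apply: (normal_unique (steps_trans S1 T)).
  - by split=> S; apply/(IH z Nz).
  - by rewrite (IH1 z Nz); apply: IH2.
move=> G Nx Ny; have /(key _ _ G) S : steps x x by apply: rt1n_refl.
by apply: steps_normal (S Nx) Ny.
Qed.

Lemma same_side_run1 x i j (b : 'I_n) : x j < b < x i -> same_side_run x i j [set b].
Proof.
move=> hb; apply/and4P; split.
- by apply/set0Pn; exists b; rewrite inE.
- by apply/forall_inP => u /set1P ->.
- apply/forall_inP => u /set1P ->; apply/forall_inP => w /set1P ->.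
  by apply/forallP => v; apply/implyP; lia.
- by apply/forall_inP => u /set1P ->; apply/forall_inP => w /set1P ->.
Qed.

Lemma clump_containing x i j (b : 'I_n) : x j < b < x i ->
  exists2 C, C \in clumps x i j & b \in C.
Proof.
move=> /same_side_run1 /maxset_exists[C mC bC].
by exists C; [rewrite inE | rewrite -finset.sub1set].
Qed.

(** Three alternating values lie in three clumps, since a clump containing [b] and [d] is convex and
    would contain [c]. Conversely, without such values, all intermediate values on one side form a
    single run, so each side has at most one clump. *)
Lemma two_clumped_normal x : two_clumped x <-> normal x.
Proof.
split=> [T i j [ji lt [b [c [d [[h1 h2 h3 h4] s1 s2]]]]]|N i j ji lt].
- have [|B mB bB] := @clump_containing x i j b; first lia.
  have [|C mC cC] := @clump_containing x i j c; first lia.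
  have [|D mD dD] := @clump_containing x i j d; first lia.
  have run E : E \in clumps x i j -> same_side_run x i j E by rewrite inE => /maxsetP[].
  have side E (u w : 'I_n) :
      E \in clumps x i j -> u \in E -> w \in E -> on_left x i u = on_left x i w.
    move=> /run /and4P[_ _ _ /forall_inP h] uE wE.
    by move/forall_inP: (h u uE) => /(_ w wE) /eqP.
  have nBC : B != C.
    by apply: contra s2 => /eqP e; rewrite e in bB; rewrite (side C _ _ mC cC bB).
  have nCD : C != D.
    by apply: contra s2 => /eqP e; rewrite e in cC; rewrite (side D _ _ mD cC dD) s1.
  have nBD : B != D.
    apply: contra s2 => /eqP e; rewrite -e in dD.
    suff cB : c \in B by rewrite (side B _ _ mB cB bB).
    have /and4P[_ _ h _] := run B mB; move: h.
    move=> /forall_inP/(_ b bB)/forall_inP/(_ d dD)/forallP/(_ c)/implyP h.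
    by apply: h; lia.
  have := T i j ji lt; apply/negP; rewrite -ltnNge.
  have u3 : uniq [:: B; C; D] by rewrite /= !inE negb_or nBC nBD nCD.
  rewrite -[3]/(size [:: B; C; D]) -(card_uniqP u3); apply: subset_leq_card.
  by apply/fintype.subsetP => E; rewrite 2!in_cons mem_seq1 => /or3P[] /eqP ->.
- pose S (s : bool) := [set u : 'I_n | (x j < u < x i) && (on_left x i u == s)].
  have convex s (u v w : 'I_n) : u \in S s -> w \in S s -> u < v < w -> v \in S s.
    rewrite !inE => /andP[hu /eqP su] /andP[hw /eqP sw] huvw.
    apply/andP; split; first lia; rewrite -su.
    apply: contraT => ne; case: (N i j); split=> //; exists u, v, w.
    by split; [split; lia | rewrite su sw | ].
  suff sub : clumps x i j \subset [set S s | s : bool].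
    apply: leq_trans (subset_leq_card sub) _.
    by apply: leq_trans (leq_imset_card _ _) _; rewrite card_bool.
  apply/fintype.subsetP => C; rewrite inE => /maxsetP[/and4P[/set0Pn[b bC] hC _ sC] mC].
  apply/imsetP; exists (on_left x i b) => //.
  have CS : C \subset S (on_left x i b).
    apply/fintype.subsetP => u uC; rewrite inE; move/forall_inP: hC => /(_ u uC) -> /=.
    by move/forall_inP: sC => /(_ u uC) /forall_inP /(_ b bC).
  (* A clump is a maximal run, so it equals the run of all intermediate values on its side. *)
  symmetry; apply: mC => //; apply/and4P; split.
  + by apply/set0Pn; exists b; apply: (fintype.subsetP CS).
  + by apply/forall_inP => u; rewrite inE => /andP[].
  + apply/forall_inP => u hu; apply/forall_inP => w hw; apply/forallP => v; apply/implyP.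
    exact: convex hu hw.
  + apply/forall_inP => u; rewrite inE => /andP[_ /eqP ->]; apply/forall_inP => w.
    by rewrite inE => /andP[_ /eqP ->].
Qed.

End Rewriting.

(** * Contractions preserve the tiles of [rho] *)

Section RhoSwap.
Variable n : nat.
Implicit Types (x y : 'S_n) (i j : 'I_n).
Local Open Scope nat_scope.

Lemma posn_at y i : posn y (y i) = i.
Proof. by rewrite (posn_ord y (y i)) permK. Qed.

Lemma posn_swapL y i j : posn (swap y i j) (y i) = j.
Proof. by rewrite (posn_ord _ (y i)) swap_inv permK tpermL. Qed.

Lemma posn_swapR y i j : posn (swap y i j) (y j) = i.
Proof. by rewrite (posn_ord _ (y j)) swap_inv permK tpermR. Qed.

Lemma posn_swapD y i j k : k <> y i :> nat -> k <> y j :> nat ->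
  [/\ posn (swap y i j) k = posn y k, posn y k <> i & posn y k <> j].
Proof.
have neq (l m : 'I_n) : l <> y m :> nat -> m != (y^-1)%g l.
  by move=> h; apply/eqP => e; apply: h; rewrite e permKV.
case: (ltnP k n) => kn; last first.
  by rewrite /posn insubN -?leqNgt // => _ _; split=> //; have := ltn_ord i; have := ltn_ord j; lia.
rewrite -[k]/(val (Ordinal kn)) => /neq ki /neq kj.
rewrite /= (posn_ord _ (Ordinal kn)) (posn_ord y (Ordinal kn)) swap_inv tpermD //.
by split=> // /ord_inj e; [rewrite e eqxx in ki | rewrite e eqxx in kj].
Qed.

Lemma bef_swap y i j v k l : j = i.+1 :> nat ->
  ~ (k = y i :> nat /\ l = y j :> nat) -> ~ (k = y j :> nat /\ l = y i :> nat) ->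
  bef (swap y i j) v k l = bef y v k l.
Proof.
move=> ji h1 h2.
have F := (posn_swapL, posn_swapR, posn_at).
have cmp k' : [\/ k' = y i :> nat, k' = y j :> nat |
    [/\ posn (swap y i j) k' = posn y k', posn y k' <> i & posn y k' <> j]].
  have [->|/eqP ki] := eqVneq k' (y i); first exact: Or31.
  have [->|/eqP kj] := eqVneq k' (y j); first exact: Or32.
  by apply: Or33; apply: posn_swapD.
rewrite /bef; case: (cmp k) => [ki|kj|[ke k1 k2]]; case: (cmp l) => [li|lj|[le l1 l2]].
- by rewrite ki li !F; case: v; lia.
- by case: h1.
- by rewrite ki le !F; case: v; lia.
- by case: h2.
- by rewrite kj lj !F; case: v; lia.
- by rewrite kj le !F; case: v; lia.
- by rewrite ke li !F; case: v; lia.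
- by rewrite ke lj !F; case: v; lia.
- by rewrite ke le.
Qed.

Lemma on_left_posn y i (b : 'I_n) : on_left y i b = (posn y b < i).
Proof. by rewrite posn_ord. Qed.

(** The swap changes only the comparison of [y j] with [y i], which could matter for [k = y j]
    alone. But [b] and [c] are on opposite sides, so one of them stops the search before it reaches
    [y i]. *)
Lemma is_upp_swap y i j v k X : contractible y i j ->
  is_upp (swap y i j) v k X -> is_upp y v k X.
Proof.
move=> [ji lt [b [c [d [[h1 h2 h3 h4] _]]]]]; rewrite !on_left_posn => s2 [u1 u2 u3].
have nb : posn y b <> i /\ posn y b <> j by have [] := @posn_swapD y i j b; lia.
have nc : posn y c <> i /\ posn y c <> j by have [] := @posn_swapD y i j c; lia.
have [ka|ka] := eqVneq k (y j); last first.
  by split=> // [Xn|l hl]; rewrite -(bef_swap v ji); auto; lia.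
have B (l : nat) : l <> y i :> nat -> bef (swap y i j) v k l = bef y v k l.
  by move=> hl; rewrite (bef_swap v ji) //; lia.
have Xe : X < y i.
  rewrite ltnNge; apply/negP => le.
  have := u3 b; have := u3 c; rewrite !B; try lia.
  by rewrite ka /bef posn_at; case: (v); lia.
split=> // [Xn|l hl]; rewrite -B; auto; lia.
Qed.

Lemma is_low_swap y i j v k X : contractible y i j ->
  is_low (swap y i j) v k X -> is_low y v k X.
Proof.
move=> [ji lt [b [c [d [[h1 h2 h3 h4] _]]]]]; rewrite !on_left_posn => s2 [u1 u2 u3].
have nb : posn y b <> i /\ posn y b <> j by have [] := @posn_swapD y i j b; lia.
have nc : posn y c <> i /\ posn y c <> j by have [] := @posn_swapD y i j c; lia.
have [ka|ka] := eqVneq k (y i); last first.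
  by split=> // [Xn|l hl]; rewrite -(bef_swap v ji); auto; lia.
have B (l : nat) : l <> y j :> nat -> bef (swap y i j) v l k = bef y v l k.
  by move=> hl; rewrite (bef_swap v ji) //; lia.
have Xe : y j < X.-1.
  rewrite ltnNge; apply/negP => le.
  have := u3 b; have := u3 c; rewrite !B; try lia.
  by rewrite ka /bef posn_at; case: (v); lia.
split=> // [Xn|l hl]; rewrite -B; auto; lia.
Qed.

Lemma rho_rect_swap y i j : contractible y i j ->
  rho_rect (swap y i j) =1 rho_rect y.
Proof.
move=> R k; have := rho_rect_spec y k; have := rho_rect_spec (swap y i j) k.
case: (rho_rect y k) => l r b t; case: (rho_rect (swap y i j) k) => l' r' b' t'.
move=> [/= /(is_low_swap R) h1 /(is_upp_swap R) h2
  [t'n /(is_low_swap R) h3] [b'n /(is_upp_swap R) h4]].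
move=> [/= g1 g2 [tn g3] [bn g4]].
rewrite (is_low_inj g1 h1) (is_upp_inj g2 h2).
have := is_low_inj g3 h3; have := is_upp_inj g4 h4.
by move=> e1 e2; congr Rect; lia.
Qed.

End RhoSwap.

(** * Contacts and common lines of tiles of [rho x] *)

Section RhoCoordinates.
Variable n : nat.
Implicit Types (x y : 'S_n) (i j k : 'I_n).
Local Open Scope nat_scope.

(* The coordinate of an edge of a tile of rho x, measured from the left for
   v = true and from the top for v = false, so that it grows with the labels. *)
Definition upp x (v : bool) k : nat :=
  if v then rgt (rho_rect x k) else n - bot (rho_rect x k).
Definition low x (v : bool) k : nat :=
  if v then lft (rho_rect x k) else n - top (rho_rect x k).

Lemma uppP x v k : is_upp x v k (upp x v k).
Proof. by have [? ? [? ?] [? ?]] := rho_rect_spec x k; case: v. Qed.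

Lemma lowP x v k : is_low x v k (low x v k).
Proof. by have [? ? [? ?] [? ?]] := rho_rect_spec x k; case: v. Qed.

Lemma bot_le x k : bot (rho_rect x k) <= n.
Proof. by have [? ? [? ?] [? ?]] := rho_rect_spec x k. Qed.

Lemma top_le x k : top (rho_rect x k) <= n.
Proof. by have [? ? [? ?] [? ?]] := rho_rect_spec x k. Qed.

Lemma bef_trans x v (i j k : nat) : bef x v i j -> bef x v j k -> bef x v i k.
Proof. by rewrite /bef; case: v; lia. Qed.

Lemma befN x v (i j : nat) : i < n -> j < n -> i <> j -> ~~ bef x v i j = bef x v j i.
Proof.
by move=> hi hj ne; have := @posn_inj _ x i j hi hj; rewrite /bef; case: v; lia.
Qed.

Lemma befNv x v (i j : nat) : bef x (~~ v) i j = bef x v j i.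
Proof. by case: v. Qed.

Lemma low_lt_upp x v k : low x v k <= k < upp x v k.
Proof. by have [] := lowP x v k; have [] := uppP x v k; lia. Qed.

Lemma upp_le x v k : upp x v k <= n.
Proof. by have [] := uppP x v k; lia. Qed.

Lemma bef_asym x v (i j : nat) : bef x v i j -> ~~ bef x v j i.
Proof. by rewrite /bef; case: v; lia. Qed.

(** The labels strictly between [i] and [j] precede [i], which precedes [j], in the sense of [bef].
    Hence none of them bounds the tile of [j] before it reaches [i], and both tiles contain the
    perpendicular coordinate [i]. *)
Lemma upp_contact x v i j : upp x v i = j :> nat ->
  [/\ low x v j = j, low x (~~ v) i <= i <= upp x (~~ v) i &
      low x (~~ v) j <= i <= upp x (~~ v) j].
Proof.
move=> e; have [h1 h2 h3] := uppP x v i; rewrite e in h1 h2 h3.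
have ij : bef x v i j by apply: h2.
have ni (l : nat) : i < l < j -> bef x v l i.
  by move=> hl; rewrite -befN; try lia; apply: h3.
split; last 2 first.
- by have := low_lt_upp x (~~ v) i; lia.
- apply/andP; split; last by have := low_lt_upp x (~~ v) j; lia.
  apply/(is_lowP i (lowP x (~~ v) j)) => l hl; rewrite befNv.
  have [->|ne] := eqVneq l i; first exact: bef_asym.
  by apply: bef_asym; apply: bef_trans ij; apply: ni; lia.
- apply: (is_low_inj (lowP x v j)); split=> //; last by move=> l; lia.
  move=> j0; have [->//|ne] := eqVneq (j.-1) i.
  by apply: bef_trans ij; apply: ni; lia.
Qed.

Lemma low_contact x v i j : low x v j = i.+1 :> nat ->
  [/\ upp x v i = i.+1, low x (~~ v) i <= j.+1 <= upp x (~~ v) i &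
      low x (~~ v) j <= j.+1 <= upp x (~~ v) j].
Proof.
move=> e; have [h1 h2 h3] := lowP x v j; rewrite e /= in h1 h2 h3.
have ij : bef x v i j by apply: h2.
have ni (l : nat) : i < l < j -> bef x v j l.
  by move=> hl; have jn := ltn_ord j; rewrite -befN ?h3 //; lia.
split; last 2 first.
- apply/andP; split; first by have := low_lt_upp x (~~ v) i; lia.
  apply/(is_uppP (uppP x (~~ v) i)); first by have := ltn_ord j; lia.
  move=> l hl; rewrite befNv; have [->|ne] := eqVneq l j; first exact: bef_asym.
  by apply: bef_asym; apply: bef_trans ij _; apply: ni; lia.
- by have := low_lt_upp x (~~ v) j; lia.
- apply: (is_upp_inj (uppP x v i)); split=> //; [|move=> _|by move=> l; lia].
    by have := ltn_ord j; lia.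
  have [->//|ne] := eqVneq (i.+1) j.
  by apply: bef_trans ij _; apply: ni; lia.
Qed.

Lemma upp_swap y i j v k : contractible y i j -> upp (swap y i j) v k = upp y v k.
Proof. by move=> R; rewrite /upp (rho_rect_swap R). Qed.

Lemma low_swap y i j v k : contractible y i j -> low (swap y i j) v k = low y v k.
Proof. by move=> R; rewrite /low (rho_rect_swap R). Qed.

(* Edges are indexed by b as lo_edge (b = false) and hi_edge (b = true). *)
Definition edge_pos x (v b : bool) k : nat :=
  if b == v then upp x v k else low x v k.

(** A common line between the two labels would put [b] and [c], or [c] and [d], on the same side. A
    common line beyond one of the labels would fix the order of [y j] and [y i], yet the swap
    reverses this order and keeps the tiles. *)
Lemma contractible_edge_pos y i j v b b' : contractible y i j ->
  edge_pos y v b (y j) != edge_pos y v b' (y i).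
Proof.
move=> R; have [ji lt [b0 [c [d [[h1 h2 h3 h4]]]]]] := R.
rewrite !on_left_posn => s1 s2.
have F := (posn_swapL, posn_swapR, posn_at).
have := low_lt_upp y v (y i); have := low_lt_upp y v (y j) => la le.
have [_ _ ua] := uppP y v (y j); have [_ _ ub] := lowP y v (y i).
have [_ _ ua'] := uppP (swap y i j) v (y j); have [_ _ ub'] := lowP (swap y i j) v (y i).
rewrite upp_swap // in ua'; rewrite low_swap // in ub'.
rewrite /edge_pos; apply/eqP; case: (b == v); case: (b' == v) => e.
- have hyi : y j < y i < upp y v (y j) by lia.
  by have := ua _ hyi; have := ua' _ hyi; rewrite /bef !F; case: (v); lia.
- have D (k : nat) : y j < k < y i -> posn y k <> i /\ posn y k <> j.
    by move=> hk; have [] := @posn_swapD n y i j k; lia.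
  have {}ua (k : nat) : k < upp y v (y j) -> y j < k -> ~~ bef y v (y j) k.
    by move=> *; apply: ua; lia.
  have {}ub (k : nat) : k < y i -> upp y v (y j) <= k -> ~~ bef y v k (y i).
    by move=> *; apply: ub; lia.
  move: (upp y v (y j)) ua ub => X ua ub.
  have lb : y j < c by lia.
  have uc : c < y i by lia.
  case: (ltnP c X) => cX.
    have := ua c cX lb; have := ua b0 (ltn_trans h2 cX) h1.
    have [] := D b0; first lia; have [] := D c; first lia.
    by move: s2; rewrite /bef !F; clear -ji; case: (v); lia.
  have := ub c uc cX; have := ub d h4 (leq_trans cX (ltnW h3)).
  have [] := D d; first lia; have [] := D c; first lia.
  by move: s2; rewrite s1 /bef !F; clear -ji; case: (v); lia.
- lia.
- have hyj : low y v (y i) <= y j < y i by lia.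
  by have := ub _ hyj; have := ub' _ hyj; rewrite /bef !F; case: (v); lia.
Qed.

(** * Reading one or two clumps off the coordinates *)

Section Clumps.
Variables (x : 'S_n) (v : bool) (a e : 'I_n).

(** With all intermediate values on one side, the order of [a] and [e] is visible in a coordinate:
    here in an edge of [a], and for the opposite order, in [one_clump_low], in an edge of [e] in the
    other direction. *)
Lemma one_clump_upp : a < e -> bef x v a e ->
  (forall k : nat, a < k < e -> bef x v k a) -> upp x v a = e.
Proof.
move=> ae bae H; apply: (is_upp_inj (uppP x v a)); split=> //.
  by have := ltn_ord e; lia.
by move=> k hk; apply/bef_asym/H.
Qed.

Lemma one_clump_low : a < e -> bef x v e a ->
  (forall k : nat, a < k < e -> bef x v k e) -> low x (~~ v) e = a.+1.
Proof.
move=> ae bae H; apply: (is_low_inj (lowP x (~~ v) e)); split=> //.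
  by rewrite befNv.
by move=> k hk; rewrite befNv; apply/bef_asym/H.
Qed.

(** [X] is the smallest value of the upper one of two clumps on opposite sides. *)
Variable X : 'I_n.
Hypotheses (aX : a.+1 < X) (Xe : X < e).
Hypothesis clump_lo : forall k : nat, a < k < X -> bef x v k a /\ bef x v k e.
Hypothesis clump_hi : forall k : nat, X <= k < e -> bef x v a k /\ bef x v e k.

Lemma two_clumps_wall : upp x v a = X /\ low x v e = X.
Proof.
split.
- apply: (is_upp_inj (uppP x v a)); split=> [||k hk].
  + by have := ltn_ord X; lia.
  + by move=> _; have [] := clump_hi (k := X); lia.
  + by apply: bef_asym; have [] := clump_lo hk.
- apply: (is_low_inj (lowP x v e)); split=> [||k hk]; first lia.
  + by move=> _; have [] := clump_lo (k := X.-1); lia.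
  + by apply: bef_asym; have [] := clump_hi hk.
Qed.

(** The extremal value [D] of the lower clump follows [a] on the same side of the line [X], its
    perpendicular edge being level with that of [a]. So [a] is not the tile excluded at the end of
    the wall, and is recorded there; [C] below does the same for [e]. *)
Lemma two_clumps_lo :
  exists D : 'I_n, upp x v D = X /\ low x (~~ v) D = upp x (~~ v) a.
Proof.
have [||D [Dn hD H]] := @exists_extremal n x v (fun k : nat => a < k < X) a.+1; try lia.
  by have := ltn_ord X; lia.
have [Da De] := clump_lo hD; exists (Ordinal Dn); split.
- apply: (is_upp_inj (uppP x v _)); split=> /= [||k hk].
  + by have := ltn_ord X; lia.
  + by move=> _; apply: bef_trans Da _; have [] := clump_hi (k := X); lia.
  + by apply: bef_asym; apply: H; have := ltn_ord X; lia.
- transitivity a.+1.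
  + apply: (is_low_inj (lowP x (~~ v) _)); split=> /= [||k hk]; first lia.
      by rewrite befNv.
    by rewrite befNv; apply: bef_asym; apply: H; lia.
  + symmetry; apply: (is_upp_inj (uppP x (~~ v) _)); split=> [||k hk]; try lia.
    by rewrite befNv => _; have [] := clump_lo (k := a.+1); lia.
Qed.

Lemma two_clumps_hi :
  exists C : 'I_n, low x v C = X /\ low x (~~ v) e = upp x (~~ v) C.
Proof.
have [||C [Cn hC H]] := @exists_extremal n x (~~ v) (fun k : nat => X <= k < e) X;
  [exact: ltn_ord | lia | ].
have {}H (k : nat) : X <= k < e -> k != C -> bef x v C k.
  by move=> hk kC; rewrite -befNv; apply: H => //; have := ltn_ord e; lia.
have [aC eC] := clump_hi hC; exists (Ordinal Cn); split.
- apply: (is_low_inj (lowP x v _)); split=> /= [||k hk]; first lia.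
  + by move=> _; apply: bef_trans aC; have [] := clump_lo (k := X.-1); lia.
  + by apply: bef_asym; apply: H; lia.
- transitivity (e : nat).
  + apply: (is_low_inj (lowP x (~~ v) _)); split=> [||k hk]; try lia.
    by rewrite befNv => _; have [] := clump_hi (k := e.-1); lia.
  + symmetry; apply: (is_upp_inj (uppP x (~~ v) _)); split=> /= [||k hk].
    * by have := ltn_ord e; lia.
    * by rewrite befNv.
    * by rewrite befNv; apply: bef_asym; apply: H; lia.
Qed.

End Clumps.

End RhoCoordinates.

(** * Tilings and walls *)

Local Open Scope classical_set_scope.
Local Open Scope ring_scope.

Section Coordinates.
Variable R : realType.
Implicit Types (r : rect R) (W S : segment R) (q : R * R) (v b : bool).

(** The flag selects the direction ([true] for horizontal coordinates, hence vertical edges), so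
    that each argument about walls is given once. *)
Definition coord v q : R := if v then q.1 else q.2.
Definition mkpoint v (s t : R) : R * R := if v then (s, t) else (t, s).
Definition clo v r : R := if v then lft r else bot r.
Definition chi v r : R := if v then rgt r else top r.
Definition edge v b r : segment R := if b then hi_edge v r else lo_edge v r.
Definition edge_coord v b r : R := if b then chi v r else clo v r.

Lemma edgeE v b r :
  edge v b r = Segment v (edge_coord v b r) (clo (~~ v) r) (chi (~~ v) r).
Proof. by case: v b => [] []. Qed.

Lemma coord_mkpoint v s t : coord v (mkpoint v s t) = s /\ coord (~~ v) (mkpoint v s t) = t.
Proof. by case: v. Qed.

Lemma seg_pointE W t : seg_point W t = mkpoint (vertical W) (axis_coord W) t.
Proof. by rewrite /seg_point; case: (vertical W). Qed.

Lemma seg_pointsE W q : seg_points W q <->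
  coord (vertical W) q = axis_coord W /\ lo W <= coord (~~ vertical W) q <= hi W.
Proof.
rewrite /seg_points /seg_point; case: W q => -[] c l h [q1 q2] /=; split.
- by move=> [t ht [<- <-]].
- by move=> [-> hq]; exists q2.
- by move=> [t ht [<- <-]].
- by move=> [-> hq]; exists q1.
Qed.

Lemma seg_points_mkpoint W v s t : seg_points W (mkpoint v s t) <->
  if vertical W == v then s = axis_coord W /\ lo W <= t <= hi W
  else t = axis_coord W /\ lo W <= s <= hi W.
Proof.
rewrite seg_pointsE; have [e1 e2] := coord_mkpoint v s t.
case: eqP => [->|ne]; first by rewrite e1 e2.
suff -> : vertical W = ~~ v by rewrite negbK e1 e2.
by move: ne; case: (vertical W); case: (v).
Qed.

Lemma rect_pointsE r q :
  rect_points r q <-> forall v, clo v r <= coord v q <= chi v r.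
Proof.
split; first by move=> [? ?] [].
by move=> H; split; [apply: (H true) | apply: (H false)].
Qed.

Lemma rect_interiorE r q :
  rect_interior r q <-> forall v, clo v r < coord v q < chi v r.
Proof.
split; first by move=> [? ?] [].
by move=> H; split; [apply: (H true) | apply: (H false)].
Qed.

Lemma sub_seg S W : lo S < hi S ->
  seg_points S `<=` seg_points W <->
  [/\ vertical W = vertical S, axis_coord W = axis_coord S, lo W <= lo S & hi S <= hi W].
Proof.
case: S => v c l h /= lh; split=> [H|[e1 e2 e3 e4] q].
- have := H (mkpoint v c l); have := H (mkpoint v c h).
  rewrite !seg_points_mkpoint /= eqxx => h1 h2.
  have {h1} : if vertical W == v then c = axis_coord W /\ lo W <= h <= hi W
     else h = axis_coord W /\ lo W <= c <= hi W by apply: h1; split=> //; lra.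
  have {h2} : if vertical W == v then c = axis_coord W /\ lo W <= l <= hi W
     else l = axis_coord W /\ lo W <= c <= hi W by apply: h2; split=> //; lra.
  case: eqP => [-> [-> ?] [_ ?]|_ [? _] [? _]]; last lra.
  by split=> //; lra.
- by rewrite !seg_pointsE /= e1 e2 => -[-> ?]; split=> //; lra.
Qed.

Lemma adjacentE n (L : layout R n) v (i j : 'I_n) : adjacent v L i j <->
  chi v (tile L i) = clo v (tile L j) /\
  exists t, clo (~~ v) (tile L i) <= t <= chi (~~ v) (tile L i) /\
            clo (~~ v) (tile L j) <= t <= chi (~~ v) (tile L j).
Proof.
rewrite /adjacent -[hi_edge _ _]/(edge v true _) -[lo_edge _ _]/(edge v false _) !edgeE.
split.
- move=> [q [/seg_pointsE /= [e1 h1] /seg_pointsE /= [e2 h2]]].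
  by split; [rewrite -e1 | exists (coord (~~ v) q)].
- move=> [e [t [h1 h2]]]; exists (mkpoint v (chi v (tile L i)) t).
  by split; rewrite seg_points_mkpoint /= eqxx.
Qed.

(** As [s] is finite, [c] can be moved slightly up ([b]) or down without passing any other member of
    [s]. *)
Lemma nudge b (c : R) (s : seq R) : exists m, forall z, z \in s ->
  (z < m) = (if b then z <= c else z < c) /\ (m < z) = (if b then c < z else c <= z).
Proof.
have [e e0 H] : exists2 e, 0 < e & forall z, z \in s -> z != c -> e < `|z - c|.
  elim: s => [|y s [e e0 IH]]; first by exists 1.
  have [->|ne] := eqVneq y c.
    by exists e => // z; rewrite inE => /predU1P[->|/IH //]; rewrite eqxx.
  exists (Num.min e (`|y - c| / 2)).
    by rewrite lt_min e0 /= divr_gt0 // normr_gt0 subr_eq0.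
  have : 0 < `|y - c| by rewrite normr_gt0 subr_eq0.
  move=> y0 z; rewrite inE => /predU1P[-> _|zs zc]; rewrite gt_min; apply/orP.
    by right; lra.
  by left; apply: IH.
exists (if b then c + e else c - e) => z /H {}H.
have [zc|zc|->] := ltgtP z c.
- have := H; rewrite lt_eqF // ltr0_norm ?subr_lt0 // => /(_ isT) h.
  by case: b; split; lra.
- have := H; rewrite gt_eqF // gtr0_norm ?subr_gt0 // => /(_ isT) h.
  by case: b; split; lra.
- by case: b; split; lra.
Qed.

End Coordinates.

Section Tilings.
Variables (R : realType) (n : nat) (L : layout R n).
Hypothesis tiling : is_tiling L.
Implicit Types (W : segment R) (v b : bool) (i j k : 'I_n).

Local Notation F := (frame L).
Local Notation T := (tile L).

Lemma tile_nondegenerate v i : clo v (T i) < chi v (T i).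
Proof. by case: tiling => /(_ i)[h1 h2] _ _; case: v. Qed.

Lemma tile_in_frame v i : clo v F <= clo v (T i) /\ chi v (T i) <= chi v F.
Proof.
have [_ cover _] := tiling.
have sub q : rect_points (T i) q -> rect_points F q.
  by move=> h; rewrite -cover; exists i.
have bounds (u w : bool) : rect_points F
    (edge_coord true u (T i), edge_coord false w (T i)).
  apply/sub/rect_pointsE => v'; have := tile_nondegenerate v' i.
  by rewrite /edge_coord /coord /=; case: v'; case: u; case: w => /= ?; lra.
have := bounds false false; have := bounds true true; rewrite !rect_pointsE.
move=> /(_ v) h1 /(_ v) h2; have := tile_nondegenerate v i.
by move: h1 h2; rewrite /edge_coord /coord /clo /chi; case: v => /= *; split; lra.
Qed.

(** Otherwise the midpoints of the overlaps in both directions give a point interior to two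
    tiles. *)
Lemma tile_overlap i j :
  (forall v, clo v (T i) < chi v (T j) /\ clo v (T j) < chi v (T i)) -> i = j.
Proof.
move=> H; apply/eqP; apply: contraT => ne.
have [_ _ /(_ i j ne) D] := tiling.
have mid v : exists t, clo v (T i) < t < chi v (T i) /\ clo v (T j) < t < chi v (T j).
  have [h1 h2] := H v; have h3 := tile_nondegenerate v i; have h4 := tile_nondegenerate v j.
  exists ((Num.max (clo v (T i)) (clo v (T j)) + Num.min (chi v (T i)) (chi v (T j))) / 2).
  clear D; case: (leP (clo v (T i)) (clo v (T j))) => ?;
    by case: (leP (chi v (T i)) (chi v (T j))) => ?; split; apply/andP; split; lra.
have [s hs] := mid true; have [t ht] := mid false.
suff : set0 (s, t) by [].
by rewrite -D; split; apply/rect_interiorE => -[]; rewrite /coord /=; case: hs; case: ht.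
Qed.

(* beside b c l u: the interval [l, u] contains points arbitrarily close to c
   that are greater than c if b, smaller if ~~ b. *)
Definition beside b (c l u : R) : bool := if b then l <= c < u else l < c <= u.

(** The point is nudged off all edge lines; the tile covering the nudged point is the required
    one. *)
Lemma tile_beside (c : bool -> R) (b : bool -> bool) :
  (forall v, beside (b v) (c v) (clo v F) (chi v F)) ->
  exists i, forall v, beside (b v) (c v) (clo v (T i)) (chi v (T i)).
Proof.
move=> H.
pose zs v := [:: clo v F; chi v F] ++ [seq clo v (T i) | i <- enum 'I_n]
   ++ [seq chi v (T i) | i <- enum 'I_n].
have /choice[q hq] v := nudge (b v) (c v) (zs v).
have [_ cover _] := tiling.
have : rect_points F (q true, q false).
  apply/rect_pointsE => v; rewrite (_ : coord v _ = q v); last by case: v.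
  have h := H v; have [|e1 _] := hq v (clo v F); first by rewrite inE eqxx.
  have [|_ e2] := hq v (chi v F); first by rewrite !inE eqxx orbT.
  by rewrite !ltW // ?e1 ?e2; move: h; rewrite /beside; case: (b v); lra.
rewrite -cover => -[i _ /rect_pointsE hi]; exists i => v.
have := hi v; rewrite (_ : coord v _ = q v); last by case: v.
have [|_ e1] := hq v (clo v (T i)).
  by rewrite !mem_cat (map_f (fun i => clo v (T i))) ?mem_enum ?orbT.
have [|e2 _] := hq v (chi v (T i)).
  by rewrite !mem_cat (map_f (fun i => chi v (T i))) ?mem_enum ?orbT.
rewrite !leNgt e1 e2 /beside; case: (b v); lra.
Qed.

Lemma tile_beside2 v b b' c t :
  beside b c (clo v F) (chi v F) -> beside b' t (clo (~~ v) F) (chi (~~ v) F) ->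
  exists i, beside b c (clo v (T i)) (chi v (T i)) /\
            beside b' t (clo (~~ v) (T i)) (chi (~~ v) (T i)).
Proof.
move=> h h'.
have [v'|i hi] := @tile_beside (fun v' => if v' == v then c else t)
  (fun v' => if v' == v then b else b').
  case: eqP => [->//|ne]; suff -> : v' = ~~ v by [].
  by move: ne; case: (v); case: (v').
exists i; split; first by have := hi v; rewrite eqxx.
by have := hi (~~ v); case: (v).
Qed.

Definition unobstructed v c l u : Prop :=
  [/\ clo v F <= c <= chi v F, clo (~~ v) F <= l, u <= chi (~~ v) F &
    forall i, clo v (T i) < c < chi v (T i) ->
      u <= clo (~~ v) (T i) \/ chi (~~ v) (T i) <= l].

Lemma avoids_interiorsE W : lo W < hi W ->
  avoids_interiors L W <-> unobstructed (vertical W) (axis_coord W) (lo W) (hi W).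
Proof.
case: W => v c l u /= lu; rewrite /avoids_interiors; split.
- move=> [sub D].
  have inF t : l <= t <= u -> clo v F <= c <= chi v F /\ clo (~~ v) F <= t <= chi (~~ v) F.
    move=> ht; have /sub/rect_pointsE h : seg_points (Segment v c l u) (mkpoint v c t).
      by rewrite seg_points_mkpoint /= eqxx.
    by have := h v; have := h (~~ v); have [-> ->] := coord_mkpoint v c t.
  have [|? ?] := inF l; first lra; have [|? ?] := inF u; first lra.
  split=> //; try lra; move=> i hc.
  case: (leP u (clo (~~ v) (T i))) => h1; first by left.
  case: (leP (chi (~~ v) (T i)) l) => h2; [by right | exfalso].
  have h3 := tile_nondegenerate (~~ v) i.
  have [t ht ht'] : exists2 t, l <= t <= u & clo (~~ v) (T i) < t < chi (~~ v) (T i).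
    exists ((Num.max l (clo (~~ v) (T i)) + Num.min u (chi (~~ v) (T i))) / 2);
    clear D sub; case: (leP l (clo (~~ v) (T i))) => ?; case: (leP u (chi (~~ v) (T i))) => ?;
    apply/andP; split; lra.
  suff : set0 (mkpoint v c t) by [].
  rewrite -(D i); split; first by rewrite seg_points_mkpoint /= eqxx.
  apply/rect_interiorE => v'; have [e1 e2] := coord_mkpoint v c t.
  have [->|ne] := eqVneq v' v; first by rewrite e1.
  suff -> : v' = ~~ v by rewrite e2.
  by clear -ne; move: ne; case: (v); case: (v').
- move=> [hc hl hu hT]; split.
  + move=> q /seg_pointsE /= [e he]; apply/rect_pointsE => v'.
    have [->|ne] := eqVneq v' v; first by rewrite e.
    suff -> : v' = ~~ v by lra.
    by clear -ne; move: ne; case: (v); case: (v').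
  + move=> i; rewrite -subset0 => q [/seg_pointsE /= [e he] /rect_interiorE h].
    have h1 := h v; have h2 := h (~~ v); rewrite e in h1.
    by have [] := hT i h1; lra.
Qed.

Definition max_unobstructed v c l u : Prop :=
  [/\ l < u, unobstructed v c l u, clo v F < c < chi v F &
    forall l' u', l' <= l -> u <= u' -> unobstructed v c l' u' -> l' = l /\ u' = u].

Lemma is_wallE W : is_wall L W <-> max_unobstructed (vertical W) (axis_coord W) (lo W) (hi W).
Proof.
case: W => v c l u /=; split.
- move=> [/= lu /(avoids_interiorsE (W := Segment v c l u) lu) /= fr nF H].
  have [hc hl hu _] := fr; split=> //.
  + have [nlo nhi] := nF v.
    have h b : edge_coord v b F <> c.
      move=> e; have : seg_points (Segment v c l u) `<=` seg_points (edge v b F).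
        by apply/sub_seg => //; rewrite edgeE.
      by case: b e => e; [apply: nhi | apply: nlo].
    have := h true; have := h false; rewrite /edge_coord => /eqP ? /eqP ?.
    by rewrite !lt_neqAle; lra.
  + move=> l' u' hl' hu' fr'.
    have sub : seg_points (Segment v c l u) `<=` seg_points (Segment v c l' u') by apply/sub_seg.
    have lu' : l' < u' by lra.
    have /H/(_ sub)/sub_seg : avoids_interiors L (Segment v c l' u') by apply/avoids_interiorsE.
    by move=> /(_ lu') [] /= *; split; lra.
- move=> [lu fr hc H]; split=> //=.
  + exact/avoids_interiorsE.
  + move=> v'; rewrite -[lo_edge _ _]/(edge v' false _) -[hi_edge _ _]/(edge v' true _) !edgeE.
    by split=> /(sub_seg _ (S := Segment v c l u) lu) /= [e1 e2 _ _];
      rewrite e1 /edge_coord in e2; lra.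
  + move=> [v' c' l' u'] av /(sub_seg _ (S := Segment v c l u) lu) /= [e1 e2 hl hu].
    subst v' c'; have lu' : l' < u' by lra.
    move: av => /(avoids_interiorsE (W := Segment v c l' u') lu') /= fr'.
    by have [-> ->] := H _ _ hl hu fr'.
Qed.

(** The tile found beside the segment cannot straddle the line [c], because the segment meets no
    interior; so it has an edge on that line. *)
Lemma side_tile v c l u b b' t :
  unobstructed v c l u -> clo v F < c < chi v F -> beside b' t l u ->
  exists i, edge_coord v (~~ b) (T i) = c /\
    beside b' t (clo (~~ v) (T i)) (chi (~~ v) (T i)).
Proof.
move=> [_ hl hu hT] hc ht.
have [||i [h1 h2]] := @tile_beside2 v b b' c t.
- by rewrite /beside; case: b; lra.
- by move: ht; rewrite /beside; case: b' => ?; lra.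
exists i; split=> //.
have key : ~ (clo v (T i) < c < chi v (T i)).
  by move=> /hT; move: ht h2; rewrite /beside; case: (b') => ? ? []; lra.
by move: key h1; rewrite /edge_coord /beside; case: b => /= key h; lra.
Qed.

Definition on_wall v c l u (p : bool * 'I_n) : Prop :=
  [/\ edge_coord v p.1 (T p.2) = c, l <= clo (~~ v) (T p.2) & chi (~~ v) (T p.2) <= u].

(** The union of the wall and a collinear edge touching it is again unobstructed, so maximality puts
    the edge inside the wall. *)
Lemma touch_wall v c l u b i : max_unobstructed v c l u -> edge_coord v b (T i) = c ->
  clo (~~ v) (T i) <= u -> l <= chi (~~ v) (T i) -> on_wall v c l u (b, i).
Proof.
move=> [lu [hc hl hu hT] _ H] e h1 h2.
have [f1 f2] := tile_in_frame (~~ v) i; have nd := tile_nondegenerate (~~ v) i.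
have ndv := tile_nondegenerate v i.
have [|||e1 e2] := H (Num.min l (clo (~~ v) (T i))) (Num.max u (chi (~~ v) (T i))).
- by rewrite ge_min lexx.
- by rewrite le_max lexx.
- split=> //; first by rewrite le_min hl.
    by rewrite ge_max hu.
  move=> j hj; have := hT j hj => hj1.
  have hj2 : chi (~~ v) (T i) <= clo (~~ v) (T j) \/ chi (~~ v) (T j) <= clo (~~ v) (T i).
    case: (leP (chi (~~ v) (T i)) (clo (~~ v) (T j))) => g1; first by left.
    case: (leP (chi (~~ v) (T j)) (clo (~~ v) (T i))) => g2; first by right.
    have ij : i = j.
      apply: tile_overlap => v'; have [->|ne] := eqVneq v' v.
        by move: e; rewrite /edge_coord; case: (b) => e; lra.
      suff -> : v' = ~~ v by [].
      by clear -ne; move: ne; case: (v); case: (v').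
    by subst j; move: e; rewrite /edge_coord; case: (b) => e; lra.
  have ndj := tile_nondegenerate (~~ v) j.
  rewrite ge_max le_min; case: hj1 hj2 => g1 [] g2; by [left; lra | right; lra | lra].
- split=> //=; first by rewrite -e1 ge_min lexx orbT.
  by rewrite -e2 le_max lexx orbT.
Qed.

End Tilings.

(** * Walls as equivalence classes of edges *)

Section Walls.
Variables (R : realType) (n : nat) (L : layout R n).
Hypothesis tiling : is_tiling L.
Implicit Types (W : segment R) (v b : bool) (i j k : 'I_n) (p q : bool * 'I_n).

Local Notation F := (frame L).
Local Notation T := (tile L).

Lemma finite_sup (P : pred 'I_n) (f : 'I_n -> R) z :
  exists m, [/\ z <= m, forall i, P i -> f i <= m & m = z \/ exists2 i, P i & f i = m].
Proof.
suff [m [h1 h2 h3]] : exists m, [/\ z <= m, forall i, i \in enum 'I_n -> P i -> f i <= m &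
    m = z \/ exists2 i, P i & f i = m].
  by exists m; split=> // i; apply: h2; rewrite mem_enum.
elim: (enum 'I_n) => [|i s [m [h1 h2 h3]]]; first by exists z; split=> //; left.
have [Pi|nPi] := boolP (P i); last first.
  by exists m; split=> // j; rewrite inE => /predU1P[-> /(negP nPi)|/h2].
case: (leP (f i) m) => fim.
  by exists m; split=> // j; rewrite inE => /predU1P[->|/h2].
exists (f i); split; [lra | | by right; exists i].
move=> j; rewrite inE => /predU1P[->//|js Pj]; apply: le_trans (h2 j js Pj) _; lra.
Qed.

(** The edge is extended in both directions up to the nearest tile straddling its line, or to the
    frame. *)
Lemma exists_max_unobstructed v b i : clo v F < edge_coord v b (T i) < chi v F ->
  exists l u, max_unobstructed L v (edge_coord v b (T i)) l u /\
    on_wall L v (edge_coord v b (T i)) l u (b, i).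
Proof.
set c := edge_coord v b (T i) => hc.
have [f1 f2] := tile_in_frame tiling (~~ v) i; have nd := tile_nondegenerate tiling (~~ v) i.
have ndv := tile_nondegenerate tiling v i.
pose blocks j := clo v (T j) < c < chi v (T j).
have sep j : blocks j ->
    chi (~~ v) (T i) <= clo (~~ v) (T j) \/ chi (~~ v) (T j) <= clo (~~ v) (T i).
  move=> hj.
  case: (leP (chi (~~ v) (T i)) (clo (~~ v) (T j))) => g1; first by left.
  case: (leP (chi (~~ v) (T j)) (clo (~~ v) (T i))) => g2; first by right.
  have ij : i = j.
    apply: (tile_overlap tiling) => v'; have [->|ne] := eqVneq v' v.
      by move: hj; rewrite /blocks /c /edge_coord; case: (b) => hj; lra.
    suff -> : v' = ~~ v by [].
    by clear -ne; move: ne; case: (v); case: (v').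
  by move: hj; rewrite -ij /blocks /c /edge_coord; case: (b) => hj; lra.
have [l [l1 l2 l3]] := finite_sup
  (fun j => blocks j && (chi (~~ v) (T j) <= clo (~~ v) (T i)))
  (fun j => chi (~~ v) (T j)) (clo (~~ v) F).
(* The upper end is a minimum, obtained as a maximum of negated values; it is [- u]. *)
have [u [u1 u2 u3]] := finite_sup
  (fun j => blocks j && (chi (~~ v) (T i) <= clo (~~ v) (T j)))
  (fun j => - clo (~~ v) (T j)) (- chi (~~ v) F).
have li : l <= clo (~~ v) (T i) by case: l3 => [->//|[j /andP[_ h] <-]].
have ui : chi (~~ v) (T i) <= - u.
  by case: u3 => [->|[j /andP[_ h] <-]]; rewrite opprK.
exists l, (- u); split=> //; split=> //; first lra.
- split=> //; [lra | lra | move=> j hj; case: (sep j hj) => h].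
  + by left; have := u2 j; rewrite h andbT => /(_ hj); lra.
  + by right; apply: l2; rewrite h andbT.
- move=> l' u' hl' hu' [_ hl1 hu1 H]; split.
  + apply/eqP; rewrite eq_le hl' /=; case: l3 => [->//|[j /andP[hj h] e]].
    have ndj := tile_nondegenerate tiling (~~ v) j.
    by case: (H j hj); lra.
  + apply/eqP; rewrite eq_le hu' andbT; case: u3 => [->|[j /andP[hj h] e]]; first lra.
    have ndj := tile_nondegenerate tiling (~~ v) j.
    by case: (H j hj); lra.
Qed.

(** At a crossing, the four quadrants would provide four distinct tiles with a corner at that
    point. *)
Lemma no_crossing v c l u h l' u' : is_generic L ->
  unobstructed L v c l u -> unobstructed L (~~ v) h l' u' ->
  clo v F < c < chi v F -> clo (~~ v) F < h < chi (~~ v) F ->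
  l < h < u -> ~ (l' < c < u').
Proof.
move=> gen fr fr' hc hh hlu hlu'.
have /choice[f hf] (bb : bool * bool) : exists i,
    edge_coord v (~~ bb.1) (T i) = c /\ edge_coord (~~ v) (~~ bb.2) (T i) = h.
  have [||i [h1 h2]] := @tile_beside2 _ _ _ tiling v bb.1 bb.2 c h.
  - by rewrite /beside; case: bb.1; lra.
  - by rewrite /beside; case: bb.2; lra.
  exists i; have [_ _ _ H] := fr; have [_ _ _ H'] := fr'.
  rewrite negbK in H'.
  have k1 : ~ (clo v (T i) < c < chi v (T i)).
    by move=> /H; move: h2; rewrite /beside; case: bb.2 => ? []; lra.
  have k2 : ~ (clo (~~ v) (T i) < h < chi (~~ v) (T i)).
    by move=> /H'; move: h1; rewrite /beside; case: bb.1 => ? []; lra.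
  split; [move: k1 h1 | move: k2 h2]; rewrite /edge_coord /beside;
   [case: bb.1 | case: bb.2] => /= k g; lra.
have finj : injective f.
  move=> [b1 b2] [b1' b2'] e; have [e1 e2] := hf (b1, b2); have [e1' e2'] := hf (b1', b2').
  rewrite -e /= in e1' e2' e1 e2.
  have nd := tile_nondegenerate tiling v (f (b1, b2)).
  have nd' := tile_nondegenerate tiling (~~ v) (f (b1, b2)).
  congr pair.
    by case: b1 b1' e1 e1' {e e2 e2'} nd nd' => [] [] //; rewrite /edge_coord /= => *; lra.
  by case: b2 b2' e2 e2' {e e1 e1'} nd nd' => [] [] //; rewrite /edge_coord /= => *; lra.
have := gen (mkpoint v c h); apply/negP; rewrite -leqNgt.
have <- : #|codom f| = 4%N by rewrite card_codom // card_prod card_bool.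
apply: subset_leq_card; apply/fintype.subsetP => _ /codomP[[b1 b2] ->].
have [e1 e2] := hf (b1, b2); rewrite /= in e1 e2.
rewrite inE /is_corner; move: e1 e2; rewrite /edge_coord /mkpoint.
by clear; case: (v) => /=; case: (b1); case: (b2) => /= -> ->; rewrite !eqxx ?orbT.
Qed.

(** The relation uses adjacencies only, so it can be followed along wall slides, which give no
    control over coordinates. *)
Definition edge_rel v : bool * 'I_n -> bool * 'I_n -> Prop :=
  clos_refl_sym_trans _ (fun p q => [/\ p.1, ~~ q.1 & adjacent v L p.2 q.2]).

Lemma edge_rel_step v i j : adjacent v L i j -> edge_rel v (true, i) (false, j).
Proof. by move=> A; apply: rst_step. Qed.

Lemma edge_rel_sym v p q : edge_rel v p q -> edge_rel v q p.
Proof. exact: rst_sym. Qed.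

Lemma edge_rel_trans v p q r : edge_rel v p q -> edge_rel v q r -> edge_rel v p r.
Proof. exact: rst_trans. Qed.

Lemma edge_rel_coord v p q : edge_rel v p q ->
  edge_coord v p.1 (T p.2) = edge_coord v q.1 (T q.2).
Proof.
elim=> {p q} [[b i] [b' j] /= [-> /negbTE -> /adjacentE[]]|//|p q _ -> //|p q r _ -> _ ->] //.
Qed.

Lemma edge_rel_wall v c l u p q : max_unobstructed L v c l u -> edge_rel v p q ->
  on_wall L v c l u p <-> on_wall L v c l u q.
Proof.
move=> mf.
elim=> {p q} [[b i] [b' j] /= [-> /negbTE -> /adjacentE[e [t [h1 h2]]]]|//|
  p q _ -> //|p q r _ -> _ ->] //.
split=> -[/= e1 g1 g2].
- by apply: touch_wall => //; [rewrite -e1 /edge_coord -e | lra | lra].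
- by apply: touch_wall => //; [rewrite -e1 /edge_coord -e | lra | lra].
Qed.

(* A side_tile on the opposite side of the wall, above the end of an edge, is
   adjacent to the tile of that edge and reaches higher. *)
Lemma wall_reach_end v c l u p : max_unobstructed L v c l u -> on_wall L v c l u p ->
  exists q, [/\ edge_rel v p q, on_wall L v c l u q & chi (~~ v) (T q.2) = u].
Proof.
move=> mf; have [m] := ubnP #|[pred i | chi (~~ v) (T p.2) < chi (~~ v) (T i)]|.
elim: m p => // m IH [b k] /= cm ow; have [/= e h1 h2] := ow.
have [eu|nu] := eqVneq (chi (~~ v) (T k)) u.
  by exists (b, k); split=> //; apply: rst_refl.
have nd := tile_nondegenerate tiling (~~ v) k.
have [lu fr hc _] := mf.
have [|i [e1 /= h3]] := @side_tile _ _ _ tiling v c l u b true (chi (~~ v) (T k)) fr hc.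
  by rewrite /beside lt_neqAle nu h2 andbT; lra.
have owi : on_wall L v c l u (~~ b, i) by apply: touch_wall => //; lra.
have rel : edge_rel v (b, k) (~~ b, i).
  case: b {cm ow owi} e e1; rewrite /edge_coord /= => e e1.
    by apply/edge_rel_step/adjacentE; split; [rewrite e | exists (chi (~~ v) (T k)); lra].
  by apply/edge_rel_sym/edge_rel_step/adjacentE; split;
    [rewrite e | exists (chi (~~ v) (T k)); lra].
have [|q [r1 r2 r3]] := IH (~~ b, i) _ owi; last first.
  by exists q; split=> //; apply: edge_rel_trans rel r1.
rewrite ltnS in cm; apply: leq_trans cm; apply: proper_card; apply/properP; split.
  by apply/fintype.subsetP => j; rewrite !inE; lra.
by exists i; rewrite !inE ?ltxx //; lra.
Qed.

(** Both edges are related to edges reaching the upper end of the wall. Those two coincide if they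
    are on the same side, and touch at that end otherwise. *)
Lemma wall_edge_rel v c l u p q : max_unobstructed L v c l u ->
  on_wall L v c l u p -> on_wall L v c l u q -> edge_rel v p q.
Proof.
move=> mf /(wall_reach_end mf)[[b i] [r1 [/= e1 h1 _] t1]].
move=> /(wall_reach_end mf)[[b' j] [r2 [/= e2 h2 _] t2]].
apply: edge_rel_trans r1 _; apply: edge_rel_trans (edge_rel_sym r2).
rewrite /= in t1 t2; have nd := tile_nondegenerate tiling (~~ v).
have ni := nd i; have nj := nd j.
have [bb|bb] := eqVneq b b'.
- subst b'; suff -> : i = j by apply: rst_refl.
  apply: (tile_overlap tiling) => v'; have [->|ne] := eqVneq v' v.
    have := tile_nondegenerate tiling v i; have := tile_nondegenerate tiling v j.
    by move: e1 e2; rewrite /edge_coord; case: (b) => *; lra.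
  suff -> : v' = ~~ v by lra.
  by clear -ne; move: ne; case: (v); case: (v').
- have -> : b' = ~~ b by clear -bb; case: b b' bb => [] [].
  have {}e2 : edge_coord v (~~ b) (T j) = c by clear -bb e2; case: b b' bb e2 => [] [].
  clear bb r2; case: b e1 e2; rewrite /edge_coord /= => e1 e2.
    by apply/edge_rel_step/adjacentE; split; [rewrite e1 | exists u; lra].
  by apply/edge_rel_sym/edge_rel_step/adjacentE; split; [rewrite e1 | exists u; lra].
Qed.

(** The perpendicular wall containing the end edge of [k] reaches the line [c] and cannot cross it,
    so it stops there, on the side of [k]. *)
Lemma wall_ends v c l u b b2 k : is_generic L -> max_unobstructed L v c l u ->
  on_wall L v c l u (b, k) -> l < edge_coord (~~ v) b2 (T k) < u ->
  exists W, [/\ is_wall L W, vertical W = ~~ v,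
    axis_coord W = edge_coord (~~ v) b2 (T k),
    seg_points (edge (~~ v) b2 (T k)) `<=` seg_points W &
    (if b then hi W else lo W) = c].
Proof.
move=> gen mf ow hh; have [lu fr hc _] := mf; have [hc1 hl hu _] := fr.
have hh' : clo (~~ v) F < edge_coord (~~ v) b2 (T k) < chi (~~ v) F by lra.
have [l' [u' [mf' [_ /= h1 h2]]]] := exists_max_unobstructed hh'; rewrite negbK in h1 h2.
have [_ fr' _ _] := mf'.
exists (Segment (~~ v) (edge_coord (~~ v) b2 (T k)) l' u'); split=> //.
- exact/(is_wallE tiling).
- have nd := tile_nondegenerate tiling v k.
  by rewrite edgeE negbK; apply/sub_seg.
- have nd := tile_nondegenerate tiling v k.
  have nc := no_crossing gen fr fr' hc hh' hh.
  have [/= e _ _] := ow; move: e; rewrite /edge_coord; case: (b) => /= e; lra.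
Qed.

End Walls.

(** * Invariance under wall slides *)

Section Mosaic.
Variables (R : realType) (n : nat).
Implicit Types (L M : layout R n) (W : segment R) (v b : bool) (i j k : 'I_n).

Lemma edge_rel_sub L M v :
  (forall i j, adjacent v L i j -> edge_rel M v (true, i) (false, j)) ->
  forall p q, edge_rel L v p q -> edge_rel M v p q.
Proof.
move=> H p q; elim=> {p q} [[b i] [b' j] /= [-> /negbTE -> /H //]|p|p q _|p q r _ pq _ qr].
- exact: rst_refl.
- exact: rst_sym.
- exact: edge_rel_trans pq qr.
Qed.

Lemma edge_sub_wall L W v b k : is_tiling L -> v = vertical W ->
  seg_points (edge v b (tile L k)) `<=` seg_points W ->
  on_wall L v (axis_coord W) (lo W) (hi W) (b, k).
Proof.
move=> tiling -> sub; have nd := tile_nondegenerate tiling (~~ vertical W) k.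
by move: sub; rewrite edgeE => /(sub_seg _ (S := Segment _ _ _ _) nd) /= [].
Qed.

Lemma edge_sub_axis L W v b k : is_tiling L ->
  seg_points (edge v b (tile L k)) `<=` seg_points W ->
  axis_coord W = edge_coord v b (tile L k).
Proof.
move=> tiling; have nd := tile_nondegenerate tiling (~~ v) k.
by rewrite edgeE => /(sub_seg _ (S := Segment _ _ _ _) nd) /= [].
Qed.

Lemma end_on_wall L W b k b2 : is_tiling L -> is_generic L -> is_wall L W ->
  on_wall L (vertical W) (axis_coord W) (lo W) (hi W) (b, k) ->
  lo W < edge_coord (~~ vertical W) b2 (tile L k) < hi W ->
  exists W', [/\ axis_coord W' = edge_coord (~~ vertical W) b2 (tile L k),
    seg_points (edge (~~ vertical W) b2 (tile L k)) `<=` seg_points W' &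
    if b then ends_from_lo L W' W else ends_from_hi L W' W].
Proof.
move=> tiling gen wW ow hh; have /(is_wallE tiling) mf := wW.
have [W3 [w3 v3 a3 s3 e3]] := wall_ends tiling gen mf ow hh.
have [E1 E2] := coord_mkpoint (~~ vertical W)
  (edge_coord (~~ vertical W) b2 (tile L k)) (axis_coord W).
rewrite negbK in E2.
exists W3; split=> //; case: b e3 {ow} => e3; split=> //; apply/seg_pointsE.
- by rewrite /hi_end seg_pointE v3 e3 a3 E1 E2; split=> //; lra.
- by rewrite /lo_end seg_pointE v3 e3 a3 E1 E2; split=> //; lra.
Qed.

(** The adjacencies of [U] with [A] and of [D] with [B] hold both before and after the slide. The
    lost adjacency of [U] with [B] follows from them and the new one of [D] with [A], and vice
    versa. *)
Lemma wall_slide_edge_rel L M v p q : generic_tiling L -> wall_slide_up L M ->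
  edge_rel L v p q <-> edge_rel M v p q.
Proof.
move=> [tiling gen] [W [W1 [W2 [U [D [A [B /= H]]]]]]].
case: H => [[wW lo1 hi2] [lt12 nobetween] [U1 U2 D1 D2] [A1 A2 B1 B2] [adjv' adjv]].
set w := vertical W in U1 U2 D1 D2 A1 A2 B1 B2 adjv adjv'.
have nd := tile_nondegenerate tiling (~~ w).
have {U1} [/= Uc Ul Uu] := edge_sub_wall (b := true) tiling (erefl w) U1.
have {D1} [/= Dc Dl Du] := edge_sub_wall (b := true) tiling (erefl w) D1.
have {A1} [/= Ac Al Au] := edge_sub_wall (b := false) tiling (erefl w) A1.
have {B1} [/= Bc Bl Bu] := edge_sub_wall (b := false) tiling (erefl w) B1.
have {}U2 := edge_sub_axis (b := false) tiling U2.
have {}D2 := edge_sub_axis (b := true) tiling D2.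
have {}A2 := edge_sub_axis (b := false) tiling A2.
have {}B2 := edge_sub_axis (b := true) tiling B2.
rewrite /edge_coord in Uc Dc Ac Bc U2 D2 A2 B2.
have ndU := nd U; have ndD := nd D; have ndA := nd A; have ndB := nd B.
(* If [U] ended before [W2], the wall at its end would meet [W] strictly between [W1] and [W2]. *)
have UA : axis_coord W2 <= chi (~~ w) (tile L U).
  rewrite leNgt; apply/negP => lt.
  have [||W3 [a3 _ e3]] := @end_on_wall L W true U true tiling gen wW; try by split.
    by rewrite /edge_coord; lra.
  apply: (nobetween W3); first by left.
  by rewrite a3 /edge_coord; lra.
have DB : clo (~~ w) (tile L B) <= axis_coord W1.
  rewrite leNgt; apply/negP => lt.
  have [||W3 [a3 _ e3]] := @end_on_wall L W false B false tiling gen wW; try by split.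
    by rewrite /edge_coord; lra.
  apply: (nobetween W3); first by right.
  by rewrite a3 /edge_coord; lra.
have LUA : adjacent w L U A by apply/adjacentE; split; [lra | exists (axis_coord W2); lra].
have LDB : adjacent w L D B by apply/adjacentE; split; [lra | exists (axis_coord W1); lra].
have LUB : adjacent w L U B by apply/adjacentE; split; [lra | exists (axis_coord W1); lra].
have MUA : adjacent w M U A.
  by apply/adjv; left; split=> // -[e]; subst A; lra.
have MDB : adjacent w M D B.
  by apply/adjv; left; split=> // -[e]; subst D; lra.
have MDA : adjacent w M D A by apply/adjv; right.
have [->|ne] := eqVneq v w; last first.
  have -> : v = ~~ w by clear -ne; move: ne; case: (v); case: (w).
  by split; apply: edge_rel_sub => i j /adjv' /edge_rel_step.
split; apply: edge_rel_sub => i j.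
- move=> Lij; have [[-> ->]|ne] := pselect ((i, j) = (U, B)).
    apply: edge_rel_trans (edge_rel_step MUA) _.
    apply: edge_rel_trans (edge_rel_sym (edge_rel_step MDA)) _.
    exact: edge_rel_step.
  by apply: edge_rel_step; apply/adjv; left.
- move=> /adjv[[Lij _]|[-> ->]]; first exact: edge_rel_step.
  apply: edge_rel_trans (edge_rel_step LDB) _.
  apply: edge_rel_trans (edge_rel_sym (edge_rel_step LUB)) _.
  exact: edge_rel_step.
Qed.

Lemma mosaic_edge_rel L M v p q : mosaic_equiv L M ->
  edge_rel L v p q <-> edge_rel M v p q.
Proof.
elim=> {L M} [L M [gL _ [H|H]]|//|L M _ -> //|L M N _ -> _ -> //].
- by split; apply: edge_rel_sub => i j /H /edge_rel_step.
- exact: wall_slide_edge_rel.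
Qed.

End Mosaic.

(** * Walls of rho x *)

Section RhoEdges.
Variables (R : realType) (n : nat).
Implicit Types (x y : 'S_n) (L M : layout R n) (W : segment R) (v b : bool) (i j k : 'I_n).
Implicit Types (p q : bool * 'I_n).

Local Notation rhoR x := (rho R x).

Lemma rho_edge_coord x v b k : edge_coord v b (tile (rhoR x) k) =
  (if v then edge_pos x v b k else n - edge_pos x v b k)%N%:R.
Proof.
have h1 := bot_le x k; have h2 := top_le x k.
by case: v; case: b; rewrite /edge_coord /edge_pos /upp /low //= subKn.
Qed.

Lemma edge_pos_upp x v k : edge_pos x v v k = upp x v k.
Proof. by rewrite /edge_pos eqxx. Qed.

Lemma edge_pos_low x v k : edge_pos x v (~~ v) k = low x v k.
Proof. by rewrite /edge_pos; case: v. Qed.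

Lemma edge_pos_le x v b k : (edge_pos x v b k <= n)%N.
Proof.
have := low_lt_upp x v k; have := upp_le x v k.
by rewrite /edge_pos; case: ifP => _; lia.
Qed.

Lemma rho_edge_rel_pos x v p q : edge_rel (rhoR x) v p q ->
  edge_pos x v p.1 p.2 = edge_pos x v q.1 q.2.
Proof.
move=> /edge_rel_coord; rewrite !rho_edge_coord => /eqP; rewrite eqr_nat.
have := edge_pos_le x v p.1 p.2; have := edge_pos_le x v q.1 q.2.
by case: (v); lia.
Qed.

(** The [upp] edge has index [v]: for [v = false] positions grow downwards, so it is the bottom
    edge, and [j] is below [i]. *)
Lemma rho_contact x v i j (Y : nat) : upp x v i = low x v j ->
  (low x (~~ v) i <= Y <= upp x (~~ v) i)%N ->
  (low x (~~ v) j <= Y <= upp x (~~ v) j)%N ->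
  edge_rel (rhoR x) v (v, i) (~~ v, j).
Proof.
move=> e hi hj.
have bi := bot_le x i; have ti := top_le x i; have bj := bot_le x j; have tj := top_le x j.
have Yn : (Y <= n)%N by have := upp_le x (~~ v) i; lia.
case: v e hi hj => /= e hi hj; rewrite /upp /low in e hi hj.
- apply: edge_rel_step; apply/adjacentE; split; first by rewrite /= e.
  by exists (n - Y)%:R; rewrite /= !ler_nat; lia.
- apply/edge_rel_sym/edge_rel_step/adjacentE; split => /=; first by congr (_%:R); lia.
  by exists Y%:R; rewrite /= !ler_nat; lia.
Qed.

Lemma rho_upp_rel x v i j : upp x v i = j :> nat ->
  edge_rel (rhoR x) v (v, i) (~~ v, j).
Proof. by move=> e; have [el h1 h2] := upp_contact e; apply: rho_contact h1 h2; rewrite e el. Qed.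

Lemma rho_low_rel x v i j : low x v j = i.+1 :> nat ->
  edge_rel (rhoR x) v (v, i) (~~ v, j).
Proof. by move=> e; have [el h1 h2] := low_contact e; apply: rho_contact h1 h2; rewrite e el. Qed.

(** Every edge on an interior grid line is linked to the two tiles that meet at the diagonal point
    of this line, so these edges represent its class. *)
Lemma rho_edge_rel_diagonal x v b k i j : edge_pos x v b k = j -> j = i.+1 :> nat ->
  edge_rel (rhoR x) v (b, k) (v, i) /\ edge_rel (rhoR x) v (v, i) (~~ v, j).
Proof.
move=> e ji; rewrite /edge_pos in e.
have [bv|bv] := eqVneq b v; rewrite ?bv ?eqxx ?(negbTE bv) in e *.
- have [lj _ _] := upp_contact e.
  have S : edge_rel (rhoR x) v (v, i) (~~ v, j) by apply: rho_low_rel; rewrite lj.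
  by split=> //; apply: edge_rel_trans (rho_upp_rel e) (edge_rel_sym S).
- have -> : b = ~~ v by clear -bv; move: bv; case: (b); case: (v).
  have S : edge_rel (rhoR x) v (v, i) (~~ v, k) by apply: rho_low_rel; rewrite e.
  split; first exact: edge_rel_sym.
  by apply: rho_upp_rel; have [->] : [/\ upp x v i = i.+1, true & true]
    by have [] := @low_contact _ x v i k (etrans e ji).
Qed.

Lemma rho_edge_rel x v p q :
  edge_pos x v p.1 p.2 = edge_pos x v q.1 q.2 -> (0 < edge_pos x v p.1 p.2 < n)%N ->
  edge_rel (rhoR x) v p q.
Proof.
case: p q => [b k] [b' k'] /= e hX.
have Xn : (edge_pos x v b k < n)%N by lia.
have Xn' : ((edge_pos x v b k).-1 < n)%N by lia.
have [|h _] := @rho_edge_rel_diagonal x v b k (Ordinal Xn') (Ordinal Xn) erefl;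
  first by rewrite /=; lia.
have [|h' _] := @rho_edge_rel_diagonal x v b' k' (Ordinal Xn') (Ordinal Xn) (esym e);
  first by rewrite /=; lia.
exact: edge_rel_trans h (edge_rel_sym h').
Qed.

(** An edge at [X] inside the square is related to the [upp] edge of label [X - 1] and the [low]
    edge of label [X]. In any other diagonal tiling the former is at least [X] and the latter at
    most [X], so the position is again [X]. On the border, only [0] for [low] and [n] for [upp]
    occur. *)
Lemma edge_pos_transfer x y v b k :
  (forall p q, edge_rel (rhoR x) v p q <-> edge_rel (rhoR y) v p q) ->
  edge_pos x v b k = edge_pos y v b k.
Proof.
have key x' y' : (forall p q, edge_rel (rhoR x') v p q -> edge_rel (rhoR y') v p q) ->
    (0 < edge_pos x' v b k < n)%N -> edge_pos x' v b k = edge_pos y' v b k.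
  move=> H hX; have Xn : (edge_pos x' v b k < n)%N by lia.
  have Xn' : ((edge_pos x' v b k).-1 < n)%N by lia.
  have [|h1 h2] := @rho_edge_rel_diagonal x' v b k (Ordinal Xn') (Ordinal Xn) erefl.
    by rewrite /=; lia.
  have := rho_edge_rel_pos (H _ _ h1); have := rho_edge_rel_pos (H _ _ h2).
  have -> : edge_pos y' v (v, Ordinal Xn').1 (v, Ordinal Xn').2 = upp y' v (Ordinal Xn').
    exact: edge_pos_upp.
  have -> : edge_pos y' v (~~ v, Ordinal Xn).1 (~~ v, Ordinal Xn).2 = low y' v (Ordinal Xn).
    exact: edge_pos_low.
  have := low_lt_upp y' v (Ordinal Xn'); have := low_lt_upp y' v (Ordinal Xn).
  by rewrite /=; lia.
move=> H; have := key x y (fun p q => proj1 (H p q)); have := key y x (fun p q => proj2 (H p q)).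
have := edge_pos_le x v b k; have := edge_pos_le y v b k.
have := low_lt_upp x v k; have := low_lt_upp y v k.
by rewrite /edge_pos; case: (b == v); have := ltn_ord k; lia.
Qed.

Lemma one_line_sorted x : sorted (fun u w : 'I_n => (posn x u < posn x w)%N) (one_line x).
Proof.
rewrite /one_line sorted_map; apply: (@sub_sorted _ (relpre val ltn)).
  by move=> i j /=; rewrite !posn_at.
by rewrite -sorted_map val_enum_ord iota_ltn_sorted.
Qed.

Lemma mem_one_line x k : k \in one_line x.
Proof. by rewrite -[k](permKV x) map_f // mem_enum. Qed.

Lemma filter_one_line_swap x i j (P : pred 'I_n) : j = i.+1 :> nat ->
  ~~ (P (x i) && P (x j)) ->
  filter P (one_line (swap x i j)) = filter P (one_line x).
Proof.
move=> ji nP; have tr (z : 'S_n) : ssrbool.transitive (fun u w : 'I_n => (posn z u < posn z w)%N).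
  by move=> u w t; apply: ltn_trans.
apply: (irr_sorted_eq (tr x)); first by move=> u /=; rewrite ltnn.
- have same : {in P &, (fun u w : 'I_n => (posn (swap x i j) u < posn (swap x i j) w)%N) =2
      (fun u w : 'I_n => (posn x u < posn x w)%N)}.
    move=> u w Pu Pw; apply: (bef_swap true ji).
    - move=> [/ord_inj e1 /ord_inj e2]; move: nP; rewrite -e1 -e2.
      by move: Pu Pw; rewrite /in_mem /= => -> ->.
    - move=> [/ord_inj e1 /ord_inj e2]; move: nP; rewrite -e1 -e2.
      by move: Pu Pw; rewrite /in_mem /= => -> ->.
  rewrite -(eq_in_sorted same) ?filter_all //.
  exact/(sorted_filter (tr _))/one_line_sorted.
- exact/(sorted_filter (tr _))/one_line_sorted.
- by move=> u; rewrite !mem_filter !mem_one_line.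
Qed.

End RhoEdges.

(** * Fibers of gamma *)

Section Fibers.
Variables (R : realType) (n : nat).
Implicit Types (x y : 'S_n) (L M : layout R n) (W : segment R) (v b : bool) (i j k a e : 'I_n).
Implicit Types (p q : bool * 'I_n).

Local Notation rhoR x := (rho R x).

Lemma recorded_on_wall L W c k : is_tiling L -> recorded L W (c, k) ->
  exists b, on_wall L (vertical W) (axis_coord W) (lo W) (hi W) (b, k).
Proof.
move=> tiling [W' _ [[_ sub _]|[_ sub _]]].
- by exists true; apply: edge_sub_wall.
- by exists false; apply: edge_sub_wall.
Qed.

(** If both swapped entries were recorded along [W], they would have edges on one line of [rho y],
    against [contractible_edge_pos]. *)
Lemma subword_swap y i j L W : contractible y i j -> generic_tiling L ->
  mosaic_equiv (rhoR y) L -> is_wall L W ->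
  subword (swap y i j) L W = subword y L W.
Proof.
move=> cy [tiling gen] me wW; have [ji _ _] := cy.
apply: filter_one_line_swap => //; apply/negP => /andP[/asboolP[c1 r1] /asboolP[c2 r2]].
have [b1 o1] := recorded_on_wall tiling r1; have [b2 o2] := recorded_on_wall tiling r2.
have /(is_wallE tiling) mf := wW.
have /(mosaic_edge_rel _ _ _ me) /rho_edge_rel_pos /= e := wall_edge_rel tiling mf o2 o1.
by move/eqP: (contractible_edge_pos (vertical W) b2 b1 cy).
Qed.

Lemma rho_swap y i j : contractible y i j -> rhoR (swap y i j) = rhoR y.
Proof.
by move=> cy; congr Layout; apply/funext => k; rewrite (rho_rect_swap cy).
Qed.

Lemma determined_by_swap y i j L : contractible y i j ->
  determined_by (swap y i j) L <-> determined_by y L.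
Proof.
move=> cy; rewrite /determined_by rho_swap //.
split=> -[gL me H]; split=> // W wW; first by rewrite -(subword_swap cy) //; apply: H.
by rewrite (subword_swap cy) //; apply: H.
Qed.

Lemma determined_by_Gamma x y L : Gamma x y -> determined_by x L <-> determined_by y L.
Proof.
elim=> {x y} [x y /Gamma_coverP[i [j [cy ->]]]|//|x y _ -> //|x y z _ -> _ -> //].
exact: determined_by_swap.
Qed.

Lemma gamma_Gamma x y : Gamma x y -> gamma (R := R) x = gamma y.
Proof.
move=> G; apply/seteqP; split=> L [s d]; exists s.
- by apply/(determined_by_Gamma _ G).
- by apply/(determined_by_Gamma _ G).
Qed.

Lemma wall_shuffle_inj L W (s s' : seq 'I_n) :
  is_wall_shuffle L W s -> is_wall_shuffle L W s' -> s = s'.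
Proof.
move=> [es [S H ->]] [es' [S' H' ->]]; congr map.
apply: irr_sorted_eq S S' _; first by move=> e1 e2 e3; apply: lt_trans.
  by move=> e1; apply: ltxx.
by move=> e1; apply/idP/idP => [/H/H'|/H'/H].
Qed.

(** The tile [k] precedes [i] along the wall and [l] comes after [j]. So the low end of [i] and the
    high end of [j] are interior to the wall, perpendicular walls end there, and both numbers are
    recorded. *)
Lemma edges_recorded L v i j k l : generic_tiling L ->
  edge_rel L v (true, i) (false, j) ->
  edge_rel L v (true, k) (true, i) -> edge_rel L (~~ v) (true, k) (false, i) ->
  edge_rel L v (false, l) (false, j) -> edge_rel L (~~ v) (true, j) (false, l) ->
  exists2 W, is_wall L W &
    (exists c, recorded L W (c, i)) /\ (exists c, recorded L W (c, j)).
Proof.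
move=> [tiling gen] rij rki rki' rlj rjl'.
have cij := edge_rel_coord rij; rewrite /edge_coord /= in cij.
have ki' := edge_rel_coord rki'; have jl' := edge_rel_coord rjl'.
rewrite /edge_coord /= in ki' jl'.
have nd := tile_nondegenerate tiling.
have [fi _] := tile_in_frame tiling v i; have [_ fj] := tile_in_frame tiling v j.
have [|lw [uw [mf oi]]] := @exists_max_unobstructed _ _ _ tiling v true i.
  by rewrite /edge_coord; have := nd v i; have := nd v j; lra.
set W := Segment v (chi v (tile L i)) lw uw.
have wW : is_wall L W by apply/(is_wallE tiling).
have ok : on_wall L v (chi v (tile L i)) lw uw (true, k).
  by apply/(edge_rel_wall tiling mf rki).
have oj : on_wall L v (chi v (tile L i)) lw uw (false, j).
  by apply/(edge_rel_wall tiling mf rij).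
have ol : on_wall L v (chi v (tile L i)) lw uw (false, l).
  by apply/(edge_rel_wall tiling mf rlj).
have [/= oi1 oi2 oi3] := oi; have [/= ok1 ok2 ok3] := ok.
have [/= oj1 oj2 oj3] := oj; have [/= ol1 ol2 ol3] := ol.
have sub b m : on_wall L v (chi v (tile L i)) lw uw (b, m) ->
    seg_points (edge v b (tile L m)) `<=` seg_points W.
  by move=> [/= e1 e2 e3]; rewrite edgeE; apply/sub_seg => //; apply: nd.
exists W => //; split.
- have [|W' [a' s' e']] := @end_on_wall _ _ L W true i false tiling gen wW oi.
    by rewrite /edge_coord /=; have := nd (~~ v) i; have := nd (~~ v) k; lra.
  exists (clo (~~ v) (tile L i)); exists W' => //; left; split=> //.
  exact: (sub true).
- have [|W' [a' s' e']] := @end_on_wall _ _ L W false j true tiling gen wW oj.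
    by rewrite /edge_coord /=; have := nd (~~ v) j; have := nd (~~ v) l; lra.
  exists (chi (~~ v) (tile L j)); exists W' => //; right; split=> //.
  exact: (sub false).
Qed.

(** Both permutations contain the same wall shuffle as a subword, and the order of [i] and [j] is
    that of their places in it. *)
Lemma determined_same_order x y L W i j : is_wall L W ->
  determined_by x L -> determined_by y L ->
  (exists c, recorded L W (c, i)) -> (exists c, recorded L W (c, j)) ->
  (posn x i < posn x j)%N -> (posn y i < posn y j)%N.
Proof.
move=> wW [_ _ /(_ W wW) sx] [_ _ /(_ W wW) sy] ri rj ij.
have exy := wall_shuffle_inj sx sy.
have mi : i \in subword x L W by rewrite mem_filter mem_one_line andbT; apply/asboolP.
have mj : j \in subword x L W by rewrite mem_filter mem_one_line andbT; apply/asboolP.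
have tr (z : 'S_n) : ssrbool.transitive (fun u w : 'I_n => (posn z u < posn z w)%N).
  by move=> u w t; apply: ltn_trans.
have srt z : sorted (fun u w : 'I_n => (posn z u < posn z w)%N) (subword z L W).
  exact/(sorted_filter (tr z))/one_line_sorted.
case: (ltngtP (index i (subword x L W)) (index j (subword x L W))) => lt.
- by apply: (sorted_ltn_index (tr y) (srt y)); rewrite -?exy.
- by have := sorted_ltn_index (tr x) (srt x) j i mj mi lt; lia.
- have ij' : i = j by rewrite -(nth_index i mi) lt nth_index.
  by rewrite ij' ltnn in ij.
Qed.

Lemma determined_edge_rel x y L v p q : determined_by x L -> determined_by y L ->
  edge_rel (rhoR x) v p q <-> edge_rel (rhoR y) v p q.
Proof.
move=> [_ mx _] [_ my _].
by rewrite (mosaic_edge_rel v p q mx) (mosaic_edge_rel v p q my).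
Qed.

End Fibers.

(** * Permutations determining the same tiling *)

Section Separation.
Variables (R : realType) (n : nat) (L : layout R n).
Implicit Types (x y : 'S_n) (v b : bool) (i j k a e : 'I_n).
Local Open Scope nat_scope.

Local Notation rhoR x := (rho R x).

Lemma determined_edge_pos x y v b k : determined_by x L -> determined_by y L ->
  edge_pos x v b k = edge_pos y v b k.
Proof.
by move=> dx dy; apply: (@edge_pos_transfer R) => p q; apply: determined_edge_rel dx dy.
Qed.

Section Pair.
Variables (x y : 'S_n) (a e : 'I_n).
Hypotheses (dx : determined_by x L) (dy : determined_by y L) (ae : a < e).
Hypothesis opp : forall v, bef x v a e = bef y v e a.

(** The coordinate showing the order of [a] and [e] in [x] is the same in [rho y], which forces this
    order in [y]. *)
Lemma one_clump_same_order v :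
  (forall k : nat, a < k < e -> bef x v k a /\ bef x v k e) -> False.
Proof.
move=> H; have ne : a <> e :> nat by lia.
have [b|nb] := boolP (bef x v a e).
- have u : upp x v a = e by apply: one_clump_upp => // k /H[].
  have u' : upp y v a = e.
    by rewrite -u -!edge_pos_upp; apply/esym; exact: determined_edge_pos.
  have [_ h _] := uppP y v a; rewrite u' in h.
  by have := bef_asym (h (ltn_ord e)); rewrite -opp b.
- have b : bef x v e a by rewrite -befN.
  have l : low x (~~ v) e = a.+1 by apply: one_clump_low => // k /H[].
  have l' : low y (~~ v) e = a.+1.
    by rewrite -l -!edge_pos_low; apply/esym; exact: determined_edge_pos.
  have [_ h _] := lowP y (~~ v) e; rewrite l' /= befNv in h.
  by have := h isT; rewrite -opp (negbTE nb).
Qed.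

Lemma two_clumps_same_order v (X : 'I_n) : a.+1 < X -> X < e ->
  (forall k : nat, a < k < X -> bef x v k a /\ bef x v k e) ->
  (forall k : nat, X <= k < e -> bef x v a k /\ bef x v e k) -> False.
Proof.
move=> aX Xe H1 H2; have [gL mx _] := dx.
have [ua le] := two_clumps_wall aX Xe H1 H2.
have [D [uD lD]] := two_clumps_lo aX Xe H1 H2.
have [C [lC uC]] := two_clumps_hi aX Xe H1 H2.
have rel w (p q : bool * 'I_n) : edge_pos x w p.1 p.2 = edge_pos x w q.1 q.2 ->
    0 < edge_pos x w p.1 p.2 < n -> edge_rel L w p q.
  by move=> *; apply/(mosaic_edge_rel _ _ _ mx); apply: rho_edge_rel.
have Xn := ltn_ord X.
have E w k : edge_pos x (~~ w) w k = low x (~~ w) k by rewrite -edge_pos_low negbK.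
have r1 : edge_rel L v (v, a) (~~ v, e).
  by apply: rel; rewrite /= edge_pos_upp ?edge_pos_low ua ?le //; lia.
have r2 : edge_rel L v (v, D) (v, a).
  by apply: rel; rewrite /= !edge_pos_upp uD ?ua //; lia.
have r3 : edge_rel L (~~ v) (v, D) (~~ v, a).
  apply: rel; rewrite /= E ?edge_pos_upp //.
  by have := low_lt_upp x (~~ v) D; have := low_lt_upp x (~~ v) a; have := ltn_ord D; lia.
have r4 : edge_rel L v (~~ v, C) (~~ v, e).
  by apply: rel; rewrite /= !edge_pos_low lC ?le //; lia.
have r5 : edge_rel L (~~ v) (v, e) (~~ v, C).
  apply: rel; rewrite /= E ?edge_pos_upp //.
  by have := low_lt_upp x (~~ v) C; have := low_lt_upp x (~~ v) e; have := ltn_ord e; lia.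
have [W wW [ra re]] : exists2 W, is_wall L W &
    (exists c, recorded L W (c, a)) /\ (exists c, recorded L W (c, e)).
  case: v {aX Xe H1 H2 ua le uD lD lC uC E} r1 r2 r3 r4 r5 => /= r1 r2 r3 r4 r5.
    exact: edges_recorded r1 r2 r3 r4 r5.
  (* Labels grow downwards, so along a horizontal wall [e] is below and [a] above: the roles of the
     two tiles are exchanged. *)
  have [W wW [? ?]] :=
    edges_recorded gL (edge_rel_sym r1) r4 (edge_rel_sym r5) r2 (edge_rel_sym r3).
  by exists W.
have o1 := determined_same_order wW dx dy ra re.
have o2 := determined_same_order wW dx dy re ra.
have := opp true; rewrite /bef.
by have := @posn_inj _ x a e (ltn_ord a) (ltn_ord e); lia.
Qed.

End Pair.

(** Without alternating [b], [c], [d], the intermediate values change sides at most once, which is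
    the case of one or of two clumps. *)
Lemma discordant_clumps x y i j a e : determined_by x L -> determined_by y L ->
  j = i.+1 :> nat -> a < e -> (x i = a /\ x j = e) \/ (x i = e /\ x j = a) ->
  (forall v, bef x v a e = bef y v e a) ->
  exists b c d : 'I_n, [/\ [/\ a < b, b < c, c < d & d < e],
    on_left x i b = on_left x i d & on_left x i c != on_left x i b].
Proof.
move=> dx dy ji ae vals opp; apply: contrapT => N.
have [pa pe] : (posn x a = i \/ posn x a = j) /\ (posn x e = i \/ posn x e = j).
  by case: vals => -[h1 h2]; rewrite -h1 -h2 !posn_at; auto.
have pae : posn x a <> posn x e by move/posn_inj => /(_ (ltn_ord a) (ltn_ord e)); lia.
have pk (k : nat) : a < k < e -> posn x k < i \/ j < posn x k.
  move=> hk; have kn : k < n by have := ltn_ord e; lia.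
  have := @posn_inj _ x a k (ltn_ord a) kn; have := @posn_inj _ x e k (ltn_ord e) kn; lia.
pose side (k : nat) := posn x k < i.
have B v (k : nat) : a < k < e -> side k = v -> bef x v k a /\ bef x v k e.
  by rewrite /side => hk <-; have := pk k hk; rewrite /bef; case: ifP; lia.
have B' v (k : nat) : a < k < e -> side k != v -> bef x v a k /\ bef x v e k.
  by rewrite /side => hk; have := pk k hk; rewrite /bef; case: (v); lia.
have [ex|nex] := pselect (exists k : nat, (a < k < e) && (side k != side a.+1)); last first.
  apply: (one_clump_same_order dx dy ae opp (v := side a.+1)) => k hk; apply: B => //.
  by case: (eqVneq (side k) (side a.+1)) => // ne; case: nex; exists k; rewrite hk.
(* The first value not on the side of [a.+1] starts the second clump; a later return at [k] would
   make [a.+1], [X], [k] alternate. *)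
have [X /andP[hX sX] Xmin] := ex_minnP ex.
have Xn : X < n by have := ltn_ord e; lia.
have Xa : X != a.+1 by apply: contra sX => /eqP ->.
apply: (two_clumps_same_order dx dy ae opp (v := side a.+1) (X := Ordinal Xn)) => /=
  [||k hk|k hk]; try lia.
- apply: B; first lia; case: (eqVneq (side k) (side a.+1)) => // ne.
  by have := Xmin k; rewrite ne andbT; lia.
- apply: B'; first lia; apply/negP => /eqP sk.
  have kX : k != X by apply: contra sX => /eqP <-; rewrite sk.
  have kn : k < n by have := ltn_ord e; lia.
  have an : a.+1 < n by lia.
  apply: N; exists (Ordinal an), (Ordinal Xn), (Ordinal kn).
  split; first by split=> /=; lia.
    by rewrite !on_left_posn /=; exact: esym sk.
  by rewrite !on_left_posn.
Qed.

Lemma on_left_swap x i j (b : 'I_n) : j = i.+1 :> nat -> b <> x i :> nat -> b <> x j :> nat ->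
  on_left (swap x i j) i b = on_left x i b.
Proof. by move=> ji bi bj; rewrite !on_left_posn; have [->] := posn_swapD bi bj. Qed.

Lemma swapK x i j : swap (swap x i j) i j = x.
Proof. by apply/permP => k; rewrite !swapE tpermK. Qed.

Lemma perm_increasing (s : 'S_n) :
  (forall i j, j = i.+1 :> nat -> s i < s j) -> s = 1%g.
Proof.
move=> H; apply/permP => i; rewrite perm1.
have sm (m : nat) (j : 'I_n) : i + m = j -> s i + m <= s j.
  elim: m j => [|m IH] j e; first by rewrite addn0 in e; rewrite (ord_inj e) addn0.
  have jn : j.-1 < n by have := ltn_ord j; lia.
  by have := IH (Ordinal jn); have := H (Ordinal jn) j; rewrite /=; lia.
have sl (m : nat) : m < n -> forall j, j = m :> nat -> m <= s j.
  elim: m => // m IH mn j e; have m'n : m < n by lia.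
  by have := IH m'n (Ordinal m'n) erefl; have := H (Ordinal m'n) j e; lia.
have nn : n.-1 < n by have := ltn_ord i; lia.
apply: ord_inj; have := sl i (ltn_ord i) i erefl.
have := sm (n.-1 - i) (Ordinal nn); have := ltn_ord (s (Ordinal nn)).
by rewrite /=; have := ltn_ord i; lia.
Qed.

(** If all adjacent entries of [x] appeared in the same order in [y], then [x * y^-1] would be
    increasing, hence the identity. *)
Lemma discordant_adjacent x y : x <> y ->
  exists i j, j = i.+1 :> nat /\ posn y (x j) < posn y (x i).
Proof.
move=> ne; apply: contrapT => N; apply: ne.
have : (x * y^-1 = 1)%g.
  apply: perm_increasing => i j ji; rewrite !permM -!posn_ord.
  rewrite ltnNge leq_eqVlt negb_or -leqNgt; apply/andP; split.
    apply/eqP => /(@posn_inj _ y _ _ (ltn_ord _) (ltn_ord _)) /ord_inj /perm_inj e.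
    by rewrite e in ji; lia.
  by rewrite leqNgt; apply/negP => lt; apply: N; exists i, j.
by move/(congr1 (fun z => z * y)%g); rewrite mulgKV mul1g.
Qed.

(** Induction on the distance [disc x y]. A discordant adjacent pair has three clumps, so swapping
    it, up or down in the weak order, is a step of [Gamma] that keeps the tiling determined and
    reduces the distance. *)
Lemma determined_Gamma x y : determined_by x L -> determined_by y L -> Gamma x y.
Proof.
have [m] := ubnP (disc x y); elim: m x => // m IH x xm dx dy.
have [->|/discordant_adjacent[i [j [ji lt]]]] := pselect (x = y); first exact: rst_refl.
have dlt := disc_swap ji lt.
have opp v : bef x v (x i) (x j) = bef y v (x j) (x i).
  by rewrite /bef !posn_at; case: v; lia.
have [xij|xij|/ord_inj/perm_inj e] := ltngtP (x i) (x j).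
- have [|b [c [d [[h1 h2 h3 h4] s1 s2]]]] := discordant_clumps dx dy ji xij _ opp; first by left.
  have cs : contractible (swap x i j) i j.
    split; rewrite ?swapL ?swapR //; exists b, c, d.
    by split; rewrite ?swapL ?swapR // !on_left_swap //; lia.
  have ds : determined_by (swap x i j) L by apply/(determined_by_swap L cs); rewrite swapK.
  apply: rst_trans (IH _ _ ds dy); last lia.
  by apply: rst_step; rewrite -{1}(swapK x i j); apply: step_swap.
- have opp' v : bef x v (x j) (x i) = bef y v (x i) (x j).
    by have := opp (~~ v); rewrite !befNv.
  have [|b [c [d [hb s1 s2]]]] := discordant_clumps dx dy ji xij _ opp'; first by right.
  have cx : contractible x i j by split=> //; exists b, c, d.
  have ds : determined_by (swap x i j) L by apply/determined_by_swap.
  apply: rst_trans (IH _ _ ds dy); last lia.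
  by apply: rst_sym; apply: rst_step; apply: step_swap.
- by rewrite e in ji; lia.
Qed.

Lemma edge_rel_renumber (s : 'S_n) v p q : edge_rel (renumber s L) v p q <->
  edge_rel L v (p.1, s p.2) (q.1, s q.2).
Proof.
split.
- elim=> {p q} [[b i] [b' j] /= [-> /negbTE -> A]|p|p q _|p q r _ pq _ qr].
  + exact: edge_rel_step.
  + exact: rst_refl.
  + exact: rst_sym.
  + exact: edge_rel_trans pq qr.
- suff key p' q' : edge_rel L v p' q' ->
      edge_rel (renumber s L) v (p'.1, (s^-1)%g p'.2) (q'.1, (s^-1)%g q'.2).
    by case: p q => [b i] [b' j] /key /=; rewrite !permK.
  elim=> {p' q' p q} [[b i] [b' j] /= [-> /negbTE -> A]|p|p q _|p q r _ pq _ qr].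
  + by apply: edge_rel_step; move: A; rewrite -{1}(permKV s i) -{1}(permKV s j).
  + exact: rst_refl.
  + exact: rst_sym.
  + exact: edge_rel_trans pq qr.
Qed.

(** In [rho x] the [upp] edge of a label is related to the [low] edge of the next one, in the
    direction given by their order in [x]. Carried over to [rho y], this relation forces the label
    of the first tile to be smaller, so [s * s'^-1] is increasing. *)
Lemma numbering_unique x y (s s' : 'S_n) :
  determined_by x (renumber s L) -> determined_by y (renumber s' L) -> s = s'.
Proof.
move=> [_ mx _] [_ my _].
suff : (s * s'^-1 = 1)%g by move/(congr1 (fun z => z * s')%g); rewrite mulgKV mul1g.
apply: perm_increasing => i j ji; rewrite !permM.
pose v := posn x i < posn x j.
have lj : low x v j = i.+1.
  apply: (is_low_inj (lowP x v j)); split=> [|_|k]; rewrite -?ji //; last lia.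
  have := @posn_inj _ x i j (ltn_ord i) (ltn_ord j).
  by rewrite ji /bef /v /= -ji; case: ltnP; lia.
have := @rho_low_rel R _ x v i j lj.
move/(mosaic_edge_rel _ _ _ mx)/edge_rel_renumber => /= r.
have : edge_rel (renumber s' L) v (v, (s'^-1)%g (s i)) (~~ v, (s'^-1)%g (s j)).
  by apply/edge_rel_renumber; rewrite /= !permKV.
move/(mosaic_edge_rel _ _ _ my)/rho_edge_rel_pos; rewrite /= edge_pos_upp edge_pos_low.
by have := low_lt_upp y v ((s'^-1)%g (s i)); have := low_lt_upp y v ((s'^-1)%g (s j)); lia.
Qed.

End Separation.

Theorem proposition4p4 (R : realType) (n : nat) (n_gt0 : (0 < n)%N)
    (C : set (layout R n)) (C_gRec : gRec C)
    (C_fiber : exists x : {perm 'I_n}, gamma x = C) :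
  (exists x : {perm 'I_n}, forall y : {perm 'I_n}, gamma y = C <-> Gamma x y) /\
  (exists! x : {perm 'I_n}, gamma x = C /\ two_clumped x).
Proof.
(* The class contains its defining tiling, on which all permutations of the fiber are compared. *)
have [L CL] : exists L, C L.
  have [L gL ->] := C_gRec; exists L; split=> //.
  by exists 1%g => i j; rewrite !perm1.
(* Both permutations determine [L] up to numbering, and the two numberings agree. *)
have fiber x y : gamma x = C -> gamma y = C -> Gamma x y.
  move=> gx gy; move: (CL) (CL); rewrite -{1}gx -gy => -[s ds] [s' ds'].
  have ss := numbering_unique ds ds'; rewrite -ss in ds'.
  exact: determined_Gamma ds ds'.
have [x0 gx0] := C_fiber; split.
  exists x0 => y; split; first exact: fiber.
  by move=> G; rewrite -gx0; apply/esym/gamma_Gamma.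
(* The normal form of [x0] is the 2-clumped permutation of the class. *)
have [x S N] := normalize x0; have G := steps_Gamma S.
exists x; split; first by split; [rewrite (gamma_Gamma _ G) | apply/two_clumped_normal].
move=> y [gy /two_clumped_normal Ny]; apply: Gamma_normal => //.
by apply: fiber => //; rewrite (gamma_Gamma _ G).
Qed.
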